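(* Let $E$ be a $\sigma$-MV-effect algebra. The set $\mathcal{SBO}(E)$ of sharp bounded observables on $E$, with the sum $+$ of observables and the Olson order $\preceq_s$, is a unital $\ell$-group with strong unit $q_1$ (the question observable corresponding to $1\in E$). In addition, $\mathcal{SBO}(E)$ is a subsemigroup of the partially ordered semigroup $\mathcal{BO}(E)$ of all bounded observables on $E$ under the Olson order.
   Context: An effect algebra is a partial algebra $(E;+,0,1)$ with a partial binary operation $+$ such that for all $a,b,c\in E$: (i) $a+b$ is defined iff $b+a$ is, and then $a+b=b+a$; (ii) $a+b$ and $(a+b)+c$ are defined iff $b+c$ and $a+(b+c)$ are, and then $(a+b)+c=a+(b+c)$; (iii) for each $a$ there is a unique $a'\in E$ with $a+a'=1$; (iv) if $a+1$ is defined then $a=0$. It is partially ordered by $a\le b$ iff $a+c=b$ for some $c\in E$. An MV-effect algebra is an effect algebra that is a lattice under $\le$ and in which $a\wedge b=0$ implies that $a+b$ is defined. A $\sigma$-MV-effect algebra is an MV-effect algebra in which all countable joins and meets exist. An element $a\in E$ is sharp if $a\wedge a'$ exists and equals $0$; $\mathrm{Sh}(E)$ is the set of sharp elements. An observable on $E$ is a mapping $x:\mathcal B(\mathbb R)\to E$ ($\mathcal B(\mathbb R)$ the Borel $\sigma$-algebra of $\mathbb R$) such that (i) $x(\mathbb R)=1$; (ii) if $A\cap B=\emptyset$ then $x(A)+x(B)$ is defined and $x(A\cup B)=x(A)+x(B)$; (iii) if $A_i\subseteq A_{i+1}$ for each $i$ and $\bigcup_iA_i=A$, then $x(A)=\bigvee_ix(A_i)$.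 It is bounded if $x([\alpha,\beta])=1$ for some interval $[\alpha,\beta]$, and sharp if $x(A)\in\mathrm{Sh}(E)$ for each $A\in\mathcal B(\mathbb R)$. Put $B_x(t):=x((-\infty,t))$, $t\in\mathbb R$; the system $\{B_x(t):t\in\mathbb R\}$ is the spectral resolution of $x$ and determines $x$ uniquely. Sum of bounded observables $x,y$ on $E$: $x+y$ is the unique bounded observable on $E$ whose spectral resolution is $B_{x+y}(t)=\bigvee_{r\in\mathbb Q}(B_x(r)\wedge B_y(t-r))$, $t\in\mathbb R$. Olson order: $x\preceq_s y$ iff $B_y(t)\le B_x(t)$ for each $t\in\mathbb R$. For $a\in E$, the question $q_a$ is the observable with $q_a(A)=1$ if $0,1\in A$; $q_a(A)=a$ if $1\in A$, $0\notin A$; $q_a(A)=a'$ if $0\in A$, $1\notin A$; $q_a(A)=0$ if $0,1\notin A$. A partially ordered semigroup is a semigroup with a partial order $\preceq$ such that $x\preceq y$ implies $x+z\preceq y+z$ for all $x,y,z$. An $\ell$-group here is an Abelian group with a lattice order that is invariant under translation. An element $u\ge0$ of an $\ell$-group $G$ is a strong unit if for each $g\in G$ there is an integer $n\ge1$ with $g\le nu$; a unital $\ell$-group is an $\ell$-group with a fixed strong unit. *)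

(* Defs.v *)
From HB Require Import structures.
From mathcomp Require Import all_boot all_order all_algebra.
From mathcomp Require Import all_classical all_reals all_analysis.

Set Implicit Arguments.
Unset Strict Implicit.
Unset Printing Implicit Defensive.

Import Order.TTheory GRing.Theory Num.Theory.

Local Open Scope order_scope.
Local Open Scope classical_set_scope.

(** * Effect algebras *)

(* [oplus a b = None] means that [a + b] is not defined. Equality of options
   in [oplusC] and [oplusA] says both that one side is defined iff the other
   is, and that the values then agree. [le_oplus] ties the order carried by
   the underlying [porderType] to the order of the effect algebra. *)
HB.mixin Record isEffectAlgebra (d : Order.disp_t) E of Order.POrder d E := {
  oplus : E -> E -> option E;
  ezero : E;
  eone : E;
  orthc : E -> E;
  oplusC : forall a b, oplus a b = oplus b a;
  oplusA : forall a b c,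
    obind (oplus ^~ c) (oplus a b) = obind (oplus a) (oplus b c);
  oplus_orthc : forall a b, oplus a b = Some eone <-> b = orthc a;
  oplus_eone : forall a, isSome (oplus a eone) -> a = ezero;
  le_oplus : forall a b : E, a <= b <-> exists c, oplus a c = Some b
}.

#[short(type="effectAlgType")]
HB.structure Definition EffectAlgebra (d : Order.disp_t) :=
  {E of isEffectAlgebra d E & Order.POrder d E}.

HB.mixin Record EffectAlgebra_isMV (d : Order.disp_t) E
    of EffectAlgebra d E & Order.Lattice d E := {
  oplus_meet0 : forall a b : E, (a `&` b)%O = ezero -> isSome (oplus a b)
}.

#[short(type="mvEffectAlgType")]
HB.structure Definition MVEffectAlgebra (d : Order.disp_t) :=
  {E of EffectAlgebra d E & Order.Lattice d E & EffectAlgebra_isMV d E}.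

HB.mixin Record MVEffectAlgebra_isSigma (d : Order.disp_t) E
    of MVEffectAlgebra d E := {
  countable_join : forall a : nat -> E, supremums (range a) !=set0;
  countable_meet : forall a : nat -> E, infimums (range a) !=set0
}.

#[short(type="sigmaMVEffectAlgType")]
HB.structure Definition SigmaMVEffectAlgebra (d : Order.disp_t) :=
  {E of MVEffectAlgebra d E & MVEffectAlgebra_isSigma d E}.

Definition sharp_elt d (E : effectAlgType d) (a : E) : Prop :=
  infimums [set a; orthc a] ezero.

Section EffectAlgebraTheory.
Variables (d : Order.disp_t) (E : effectAlgType d).
Implicit Types a b : E.

Lemma oplus_orthc1 a : oplus a (orthc a) = Some eone.
Proof. exact/oplus_orthc. Qed.

Lemma orthc1 : orthc (eone : E) = ezero.
Proof. by apply: oplus_eone; rewrite oplusC oplus_orthc1. Qed.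

Lemma orthcK : involutive (@orthc d E).
Proof. by move=> a; apply/esym/oplus_orthc; rewrite oplusC oplus_orthc1. Qed.

Lemma oplus0 a : oplus a ezero = Some a.
Proof.
have h10 : oplus eone ezero = Some (eone : E).
  by rewrite -orthc1 oplus_orthc1.
have := oplusA (orthc a) a ezero.
rewrite (oplusC (orthc a)) oplus_orthc1 /= h10.
case: (oplus a ezero) => //= c /esym /oplus_orthc.
by rewrite orthcK => ->.
Qed.

Lemma oplus0l a : oplus ezero a = Some a.
Proof. by rewrite oplusC oplus0. Qed.

End EffectAlgebraTheory.

(** * Observables *)

(* An observable is a map on the Borel sets of [R]. It is extended by the
   value [ezero] to the other subsets of [R], so that observables that agree
   on the Borel sets are equal. *)
Record observable (R : realType) d (E : effectAlgType d) := Observable {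
  obs_fun :> set R -> E;
  obs_nonmeasurable : forall A, ~ measurable A -> obs_fun A = ezero;
  obs_setT : obs_fun setT = eone;
  obs_setU : forall A B, measurable A -> measurable B -> A `&` B = set0 ->
    oplus (obs_fun A) (obs_fun B) = Some (obs_fun (A `|` B));
  obs_bigcup : forall A : nat -> set R, (forall i, measurable (A i)) ->
    (forall i, (A i `<=` A i.+1)) ->
    supremums (range (fun i => obs_fun (A i))) (obs_fun (\bigcup_i A i))
}.

HB.instance Definition _ (R : realType) d (E : effectAlgType d) :=
  gen_eqMixin (observable R E).
HB.instance Definition _ (R : realType) d (E : effectAlgType d) :=
  gen_choiceMixin (observable R E).

Section Observables.
Variables (R : realType) (d : Order.disp_t) (E : effectAlgType d).
Implicit Types x y : observable R E.

Definition bounded_obs x : Prop :=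
  exists alpha beta : R, x `[alpha, beta] = eone.

Definition sharp_obs x : Prop :=
  forall A : set R, measurable A -> sharp_elt (x A).

Definition BO : set (observable R E) := [set x | bounded_obs x].

Definition SBO : set (observable R E) :=
  [set x | sharp_obs x /\ bounded_obs x].

Definition spectral x (t : R) : E := x `]-oo, t[.

Definition olson_le x y : Prop := forall t : R, spectral y t <= spectral x t.

End Observables.

Section Sum.
Variables (R : realType) (d : Order.disp_t) (E : sigmaMVEffectAlgType d).
Implicit Types x y z : observable R E.

Definition is_obs_sum x y z : Prop :=
  bounded_obs z /\
  forall t : R, supremums
    (range (fun r : rat =>
       (spectral x (ratr r) `&` spectral y (t - ratr r)%R)%O))
    (spectral z t).

(* The value is irrelevant if no [z] satisfies [is_obs_sum x y z]. *)
Definition obs_sum x y : observable R E := xget x (is_obs_sum x y).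

End Sum.

(** * Questions *)

Section Question.
Variables (R : realType) (d : Order.disp_t) (E : effectAlgType d) (a : E).

Definition question_fun (A : set R) : E :=
  if ~~ `[< measurable A >] then ezero
  else if `[< A 1%R >] then (if `[< A 0%R >] then eone else a)
  else (if `[< A 0%R >] then orthc a else ezero).

Let question_nonmeasurable A : ~ measurable A -> question_fun A = ezero.
Proof. by move=> nA; rewrite /question_fun; case: asboolP. Qed.

Let question_setT : question_fun setT = eone.
Proof.
by rewrite /question_fun (asboolT (@measurableT _ _)) !(asboolT I).
Qed.

Let question_setU A B : measurable A -> measurable B -> A `&` B = set0 ->
  oplus (question_fun A) (question_fun B) = Some (question_fun (A `|` B)).
Proof.
move=> mA mB AB; rewrite /question_fun (asboolT mA) (asboolT mB).
rewrite (asboolT (measurableU _ _ mA mB)) /=.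
have AB0 (t : R) : A t -> B t -> False.
  by move=> At Bt; have : (A `&` B) t by []; rewrite AB.
rewrite !asbool_or.
case: (asboolP (A 1%R)) => A1; case: (asboolP (B 1%R)) => B1 //=;
  case: (asboolP (A 0%R)) => A0; case: (asboolP (B 0%R)) => B0 //=;
  rewrite ?oplus0 ?oplus0l ?oplus_orthc1 //;
  try (by case: (AB0 1%R)); try (by case: (AB0 0%R)).
by rewrite oplusC oplus_orthc1.
Qed.

Let question_bigcup (A : nat -> set R) : (forall i, measurable (A i)) ->
  (forall i, (A i `<=` A i.+1)) ->
  supremums (range (fun i => question_fun (A i)))
            (question_fun (\bigcup_i A i)).
Proof.
move=> mA incA; have mU : measurable (\bigcup_i A i) by exact: bigcup_measurable.
have homoA i j : (i <= j)%N -> (A i `<=` A j).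
  move=> /subnK <-; elim: (j - i)%N => [//|k IH] t At.
  by rewrite addSn; apply/incA/IH.
have stable t : exists n, forall m, (n <= m)%N -> (A m t <-> (\bigcup_i A i) t).
  have [[n _ Ant]|nU] := pselect ((\bigcup_i A i) t).
    by exists n => m nm; split=> [Amt|_]; [exists m|exact: homoA Ant].
  by exists 0%N => m _; split=> // Amt; case: nU; exists m.
have [[n1 h1] [n0 h0]] := (stable 1%R, stable 0%R).
have eqU : question_fun (A (maxn n1 n0)) = question_fun (\bigcup_i A i).
  rewrite /question_fun (asboolT (mA _)) (asboolT mU).
  by rewrite (asbool_equiv_eq (h1 _ (leq_maxl _ _)))
             (asbool_equiv_eq (h0 _ (leq_maxr _ _))).
split=> [_ [i _ <-]|b ub]; last by rewrite -eqU; apply: ub; exists (maxn n1 n0).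
apply/le_oplus; exists (question_fun (\bigcup_i A i `\` A i)).
rewrite question_setU //; last by rewrite setDE setIC -setIA setICl setI0.
  by congr (Some (question_fun _)); apply: setDUK => t At; exists i.
exact: measurableD.
Qed.

Definition question : observable R E :=
  Observable question_nonmeasurable question_setT question_setU
    question_bigcup.

End Question.

(** * Ordered algebraic structures carried by a set [S : set T] *)

Section OrderedStructures.
Variables (T : Type) (S : set T) (add : T -> T -> T) (le : T -> T -> Prop).

Record semigroup_on : Prop := SemigroupOn {
  semigroup_closed : forall x y, S x -> S y -> S (add x y);
  semigroup_assoc : forall x y z, S x -> S y -> S z ->
    add x (add y z) = add (add x y) z
}.

Record abelian_group_on (zero : T) : Prop := AbelianGroupOn {
  group_semigroup : semigroup_on;
  group_comm : forall x y, S x -> S y -> add x y = add y x;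
  group_zero : S zero;
  group_add0 : forall x, S x -> add zero x = x;
  group_opp : forall x, S x -> exists2 y, S y & add y x = zero
}.

Record partial_order_on : Prop := PartialOrderOn {
  order_refl : forall x, S x -> le x x;
  order_anti : forall x y, S x -> S y -> le x y -> le y x -> x = y;
  order_trans : forall x y z, S x -> S y -> S z -> le x y -> le y z -> le x z
}.

Record lattice_on : Prop := LatticeOn {
  lattice_order : partial_order_on;
  lattice_join : forall x y, S x -> S y -> exists z, [/\ S z, le x z, le y z &
    forall w, S w -> le x w -> le y w -> le z w];
  lattice_meet : forall x y, S x -> S y -> exists z, [/\ S z, le z x, le z y &
    forall w, S w -> le w x -> le w y -> le w z]
}.

Definition translation_monotone : Prop :=
  forall x y z, S x -> S y -> S z -> le x y -> le (add x z) (add y z).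

Record po_semigroup_on : Prop := PoSemigroupOn {
  po_semigroup : semigroup_on;
  po_semigroup_order : partial_order_on;
  po_semigroup_mono : translation_monotone
}.

Record lgroup_on (zero : T) : Prop := LgroupOn {
  lgroup_group : abelian_group_on zero;
  lgroup_lattice : lattice_on;
  lgroup_mono : translation_monotone
}.

Record strong_unit_on (zero u : T) : Prop := StrongUnitOn {
  unit_in : S u;
  unit_ge0 : le zero u;
  unit_strong : forall g, S g ->
    exists2 n : nat, (1 <= n)%N & le g (iter n (add u) zero)
}.

Definition unital_lgroup_on (u : T) : Prop :=
  exists zero : T, lgroup_on zero /\ strong_unit_on zero u.

End OrderedStructures.

Definition subsemigroup_of (T : Type) (S S' : set T) (add : T -> T -> T) :=
  (S `<=` S') /\ semigroup_on S add.

(* Main.v *)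
Require Import Defs.
From HB Require Import structures.
From mathcomp Require Import all_boot all_order all_algebra.
From mathcomp Require Import ring lra measurable_realfun.
From mathcomp Require Import all_classical all_reals all_analysis.

Set Implicit Arguments.
Unset Strict Implicit.
Unset Printing Implicit Defensive.

Import Order.TTheory GRing.Theory Num.Theory numFieldNormedType.Exports.

(** The group and order laws are lattice computations with spectral
    resolutions, once two facts are known. An observable is determined by its
    spectral resolution (pi-lambda argument, [observable_eq]). Conversely, every
    monotone left continuous [F : R -> E] that takes the values 0 and 1 is the
    spectral resolution of an observable ([observable_exists]); this produces
    sums, joins and meets, and it is where the work lies, since [E] is an
    arbitrary sigma-MV-effect algebra and its elements are not functions.

    The observable with resolution [F] is built through states. If a state
    [w : E -> R] preserves the suprema expressing left continuity of [F] at the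
    rationals, then at the rationals [w \o F] is the distribution function of a
    probability measure [m] on the line. An element [a] is to be the value at the Borel set
    [A] if [m A = w a] for all states [w] that preserve some countable family of
    suprema, which may depend on [A] and [a]. Such [a] is unique because
    countably many suprema can be preserved by a state that separates two given
    elements ([generic_separation]). The Borel sets for which such [a] exists
    form a lambda-system, because countably many countable families of suprema
    are again one countable family; it contains the half-lines, so it contains
    every Borel set.

    For [generic_separation], a decreasing sequence of nonzero elements [c_j]
    is chosen so that the annihilators of the [c_j] force one instance of one
    supremum at each step (a Rasiowa-Sikorski construction). The union of these
    annihilators is a proper ideal; a prime ideal above it has a linearly
    ordered quotient, and there the binary digits of an element are defined by
    repeated doubling. The resulting real number is additive since the error
    of additivity is halved by each doubling ([valuation_psum]).

    With the existence of sums settled, associativity and monotonicity follow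
    from the distributivity of meets over countable joins. For a sharp [x] the
    opposite is the image of [x] under reflection of the line: the values of a
    sharp observable meet as the Borel sets do, so the resolution of the sum
    joins the values of [x] on all intervals of length [t], which cover the
    line if [t > 0] and are empty otherwise ([obs_sum_opp]). *)

(** * Effect algebras: cancellation and differences *)

Section EffectAlgebraLemmas.
Local Open Scope order_scope.
Context {d : Order.disp_t} {E : effectAlgType d}.
Implicit Types a b c s t u : E.

Lemma oplus_assocl a b c s t : oplus a b = Some s -> oplus s c = Some t ->
  exists2 u, oplus b c = Some u & oplus a u = Some t.
Proof.
move=> abs sct; have := oplusA a b c; rewrite abs /= sct.
by case: (oplus b c) => //= u aut; exists u.
Qed.

Lemma oplus_assocr a b c u t : oplus b c = Some u -> oplus a u = Some t ->
  exists2 s, oplus a b = Some s & oplus s c = Some t.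
Proof.
move=> bcu aut; have := oplusA a b c; rewrite bcu /= aut.
by case: (oplus a b) => //= s sct; exists s.
Qed.

Lemma oplus_inj a b b' c : oplus a b = Some c -> oplus a b' = Some c -> b = b'.
Proof.
suff key x : oplus a x = Some c ->
    exists2 u, oplus a (orthc c) = Some u & x = orthc u.
  by move=> /key[u au ->] /key[v]; rewrite au => -[->] ->.
rewrite oplusC => xac; have [u au xu] := oplus_assocl xac (oplus_orthc1 c).
by exists u => //; apply/oplus_orthc; rewrite oplusC.
Qed.

Lemma ezero_le a : ezero <= a.
Proof. by apply/le_oplus; exists a; rewrite oplus0l. Qed.

Lemma le_eone a : a <= eone.
Proof. by apply/le_oplus; exists (orthc a); rewrite oplus_orthc1. Qed.

Lemma le_ezero a : a <= ezero -> a = ezero.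
Proof. by move=> a0; apply: le_anti; rewrite a0 ezero_le. Qed.

Lemma orthc0 : orthc (ezero : E) = eone.
Proof. by rewrite -orthc1 orthcK. Qed.

Lemma oplus_lel a b c : oplus a b = Some c -> a <= c.
Proof. by move=> abc; apply/le_oplus; exists b. Qed.

Lemma oplus_ler a b c : oplus a b = Some c -> b <= c.
Proof. by rewrite oplusC; exact: oplus_lel. Qed.

Lemma oplus_mono a b c b' c' : oplus a b = Some c -> oplus a b' = Some c' ->
  (c <= c') <-> (b <= b').
Proof.
move=> abc abc'; split=> /le_oplus[e].
  move=> cec'; have [u beu] := oplus_assocl abc cec'.
  by move=> /(oplus_inj abc') ->; exact: oplus_lel beu.
move=> beb'; have [s] := oplus_assocr beb' abc'; rewrite abc => -[<-].
exact: oplus_lel.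
Qed.

Lemma oplus_le a b c b' : oplus a b = Some c -> b' <= b ->
  exists2 c', oplus a b' = Some c' & c' <= c.
Proof.
move=> abc /le_oplus[e beb]; have [s as_ /oplus_lel sc] := oplus_assocr beb abc.
by exists s.
Qed.

Lemma oplus_le_orthc a b c : oplus a b = Some c -> b <= orthc a.
Proof.
move=> abc; have [u bu au] := oplus_assocl abc (oplus_orthc1 c).
by move/oplus_orthc : au => <-; exact: oplus_lel bu.
Qed.

Lemma oplus_anti a b a' b' c : oplus a b = Some c -> oplus a' b' = Some c ->
  a <= a' -> b' <= b.
Proof.
move=> abc abc' /le_oplus[e aea].
have [u eu au] := oplus_assocl aea abc'.
by rewrite (oplus_inj abc au); exact: oplus_ler eu.
Qed.

Lemma orthc_le a b : (orthc b <= orthc a) = (a <= b).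
Proof.
apply/idP/idP => ab; last exact: oplus_anti (oplus_orthc1 a) (oplus_orthc1 b) ab.
apply: oplus_anti ab; rewrite oplusC; exact: oplus_orthc1.
Qed.

Lemma oplus_eq0 a b : oplus a b = Some a -> b = ezero.
Proof. by move=> aba; apply: (oplus_inj aba); rewrite oplus0. Qed.

End EffectAlgebraLemmas.

(** * Truncated operations of an MV-effect algebra *)

Section MVLemmas.
Local Open Scope order_scope.
Context {d : Order.disp_t} {E : mvEffectAlgType d}.
Implicit Types a b c u v w x y z : E.

Definition ominus a b : E := xget a (fun c => oplus (a `&` b) c = Some a).

Definition otimes a b : E := ominus a (orthc b).

Definition osum a b : E := orthc (ominus (orthc a) b).

Lemma oplus_ominus a b : oplus (a `&` b) (ominus a b) = Some a.
Proof.
have /le_oplus[c abc] := leIl a b.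
exact: (@xgetPex _ a (fun c => oplus (a `&` b) c = Some a) (ex_intro _ c abc)).
Qed.

(** The differences of [a `|` b] with [a] and with [b] are disjoint, hence
    summable, and their sum stays below [a `|` b]. Removing both from [a `|` b]
    leaves [a `&` b], so that subtracting [b] from the join and the meet from
    [a] gives the same element. *)
Lemma oplus_ominus_join a b : oplus b (ominus a b) = Some (a `|` b).
Proof.
have /le_oplus[p ap] := leUl a b; have /le_oplus[q bq] := leUr b a.
have disj r : r <= p -> r <= q -> r = ezero.
  rewrite 2!le_oplus => -[p1 rp] [q1 rq]; rewrite oplusC in rp.
  have [m am mr] := oplus_assocr rp ap.
  rewrite oplusC in rq; have [m' bm mr'] := oplus_assocr rq bq.
  have mm : m = m' by apply: (@oplus_inj _ _ r _ _ (a `|` b)); rewrite oplusC.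
  have mj : m = a `|` b.
    apply: le_anti; rewrite (oplus_lel mr) leUx (oplus_lel am) mm.
    exact: oplus_lel bm.
  by move: mr; rewrite mj => /oplus_eq0.
have := oplus_meet0 p q; rewrite (disj _ (leIl _ _) (leIr _ _)) => /(_ erefl).
case pqs : (oplus p q) => [s|//] _.
have sj : s <= a `|` b.
  have /le_oplus[w jw] : p `|` q <= s.
    by rewrite leUx (oplus_lel pqs) (oplus_ler pqs).
  have w0 : w = ezero.
    apply: disj; last exact: oplus_anti pqs jw (leUl _ _).
    by rewrite oplusC in pqs; exact: oplus_anti pqs jw (leUr _ _).
  move: jw; rewrite w0 oplus0 => -[<-].
  by rewrite leUx (oplus_ler ap) (oplus_ler bq).
move: sj => /le_oplus[m sm].
have [a' qm pa'] := oplus_assocl pqs sm.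
have aE : a' = a by apply: (oplus_inj pa'); rewrite oplusC.
rewrite oplusC in pqs; have [b' pm qb'] := oplus_assocl pqs sm.
have bE : b' = b by apply: (oplus_inj qb'); rewrite oplusC.
rewrite {a'}aE {b'}bE in qm pm qb' pa'.
have /le_oplus[e me] : m <= a `&` b by rewrite lexI (oplus_ler qm) (oplus_ler pm).
rewrite oplusC in pm; rewrite oplusC in qm.
have e0 : e = ezero.
  by apply: disj; [apply/(oplus_mono me pm)/leIr|apply/(oplus_mono me qm)/leIl].
move: me; rewrite e0 oplus0 => -[mE]; rewrite mE in qm.
by rewrite (oplus_inj (oplus_ominus a b) qm).
Qed.

Lemma ominus_le a b : ominus a b <= a.
Proof. exact: oplus_ler (oplus_ominus a b). Qed.

Lemma ominus_lel a b c : a <= b -> ominus a c <= ominus b c.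
Proof.
move=> ab; apply/(oplus_mono (oplus_ominus_join a c) (oplus_ominus_join b c)).
by rewrite leU2.
Qed.

Lemma ominus_ler a b c : a <= b -> ominus c b <= ominus c a.
Proof.
move=> ab; apply: (oplus_anti (oplus_ominus c a) (oplus_ominus c b)).
by rewrite leI2.
Qed.

Lemma oplus_ominus_le a b : b <= a -> oplus b (ominus a b) = Some a.
Proof. by move=> ba; rewrite oplus_ominus_join (join_idPl ba). Qed.

Lemma oplus_ominusK a b c : oplus a b = Some c -> ominus c a = b.
Proof.
by move=> abc; exact: oplus_inj (oplus_ominus_le (oplus_lel abc)) abc.
Qed.

Lemma oplus_osum a b : oplus a (orthc a `&` b) = Some (osum a b).
Proof.
have [s as_ sb] := oplus_assocr (oplus_ominus (orthc a) b) (oplus_orthc1 a).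
rewrite as_; congr Some; move: sb; rewrite oplusC => /oplus_orthc.
by [].
Qed.

Lemma oplus_osumE a b c : oplus a b = Some c -> osum a b = c.
Proof.
move=> abc; have := oplus_osum a b; rewrite (meet_idPr (oplus_le_orthc abc)).
by rewrite abc => -[].
Qed.

(** Residuation; commutativity, monotonicity and most inequalities between
    truncated sums and differences are consequences of this adjunction. *)
Lemma ominus_leE x y z : (ominus z x <= y) = (z <= osum x y).
Proof.
have zx := oplus_ominus_join z x.
apply/idP/idP => [zxy|zxy].
  apply: le_trans (leUl z x) _; apply/(oplus_mono zx (oplus_osum x y)).
  by rewrite lexI zxy (oplus_le_orthc zx).
suff : ominus z x <= orthc x `&` y by rewrite lexI => /andP[].
apply/(oplus_mono zx (oplus_osum x y)).
by rewrite leUx zxy (oplus_lel (oplus_osum x y)).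
Qed.

Lemma ominus_ominus a b : ominus a (ominus a b) = a `&` b.
Proof. by apply: oplus_ominusK; rewrite oplusC oplus_ominus. Qed.

Lemma osumC x y : osum x y = osum y x.
Proof.
suff h u v : osum u v <= osum v u by apply: le_anti; rewrite !h.
rewrite -ominus_leE; apply: (@le_trans _ _ (ominus (osum u v) (ominus (osum u v) u))).
  by apply: ominus_ler; rewrite ominus_leE.
by rewrite ominus_ominus leIr.
Qed.

Lemma ominus_eq0 a b : ominus a b = ezero <-> a <= b.
Proof.
split=> [ab|/meet_idPl ab].
  by have := oplus_ominus a b; rewrite ab oplus0 => -[<-]; exact: leIr.
by have := oplus_ominus a b; rewrite ab => /oplus_eq0.
Qed.

Lemma ominus_disj a b : ominus a b `&` ominus b a = ezero.
Proof.
apply: le_ezero; set r := _ `&` _.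
have ra : r <= ominus a b by exact: leIl.
have rb : r <= ominus b a by exact: leIr.
have [c abr cr] := oplus_le (oplus_ominus a b) ra.
have := oplus_ominus b a; rewrite meetC => h.
have [c' + cr'] := oplus_le h rb; rewrite abr => -[cc]; rewrite -{}cc in cr'.
have cE : c = a `&` b.
  by apply: le_anti; rewrite lexI cr cr' (oplus_lel abr).
by move: abr; rewrite cE => /oplus_eq0 ->.
Qed.

Lemma osum_le x y x' y' : x <= x' -> y <= y' -> osum x y <= osum x' y'.
Proof.
have h u v w : v <= w -> osum u v <= osum u w.
  by move=> vw; rewrite -ominus_leE (le_trans _ vw)// ominus_leE.
move=> xx yy; apply: le_trans (h _ _ _ yy) _.
by rewrite osumC [leRHS]osumC; exact: h.
Qed.

Lemma osum_lel x y : x <= osum x y.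
Proof. exact: oplus_lel (oplus_osum x y). Qed.

Lemma osum_ler x y : y <= osum x y.
Proof. by rewrite osumC osum_lel. Qed.

Lemma oplus_le_osum x y z x1 y1 : oplus x1 y1 = Some z -> x1 <= x -> y1 <= y ->
  z <= osum x y.
Proof. by move=> /oplus_osumE <-; exact: osum_le. Qed.

(** The truncated sum of [x] and [y] is the largest defined sum of an element
    below [x] and one below [y]; this reduces associativity to that of [oplus]. *)
Lemma osumA x y z : osum x (osum y z) = osum (osum x y) z.
Proof.
suff h u v w : osum u (osum v w) <= osum (osum u v) w.
  apply: le_anti; rewrite h /= osumC (osumC x y).
  by rewrite [leRHS]osumC (osumC y z).
have := oplus_osum u (osum v w); set s := _ `&` _ => us.
have sv : ominus s v <= w by rewrite ominus_leE leIr.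
have [t ut tw] := oplus_assocr (oplus_ominus s v) us.
apply: oplus_le_osum tw _ sv; apply: oplus_le_osum ut _ _ => //.
exact: leIr.
Qed.

Lemma osum0 x : osum x ezero = x.
Proof. by apply: oplus_osumE; rewrite oplus0. Qed.

Lemma osum0l x : osum ezero x = x.
Proof. by rewrite osumC osum0. Qed.

Lemma osum_orthc a : osum a (orthc a) = eone.
Proof. exact/oplus_osumE/oplus_orthc1. Qed.

Lemma osum_eq1 a b : osum a b = eone <-> orthc a <= b.
Proof.
split=> [ab|ab]; last first.
  by apply: le_anti; rewrite le_eone /= -(osum_orthc a) osum_le.
have := oplus_osum a b; rewrite ab => /oplus_orthc <-; exact: leIr.
Qed.

Lemma ominus0 a : ominus a ezero = a.
Proof. by apply: oplus_ominusK; rewrite oplus0l. Qed.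

Lemma orthc_meet a b : orthc (a `&` b) = orthc a `|` orthc b.
Proof.
apply: le_anti; apply/andP; split.
  by rewrite -orthc_le orthcK lexI -orthc_le orthcK leUl -orthc_le orthcK leUr.
by rewrite leUx !orthc_le leIl leIr.
Qed.

Lemma orthc_join a b : orthc (a `|` b) = orthc a `&` orthc b.
Proof. by rewrite -[RHS]orthcK orthc_meet !orthcK. Qed.

Lemma ominus_orthc a b : ominus (orthc a) (orthc b) = ominus b a.
Proof.
have := oplus_ominus_join b a => h.
have [u + au] := oplus_assocl h (oplus_orthc1 _); move/oplus_orthc : au => ->.
rewrite orthc_join oplusC meetC => h'; exact: oplus_inj (oplus_ominus _ _) h'.
Qed.

Lemma ominus_tri a b c : ominus a c <= osum (ominus a b) (ominus b c).
Proof.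
rewrite ominus_leE (osumC (ominus a b)) osumA -ominus_leE.
by rewrite ominus_ler// -ominus_leE.
Qed.

Lemma osum_ominus2 a b c : ominus (osum a c) (osum b c) <= ominus a b.
Proof.
rewrite ominus_leE (osumC b) -osumA (osumC a); apply: osum_le => //.
by rewrite -ominus_leE.
Qed.

Lemma otimes_osum_disj a b : orthc (osum a b) `&` otimes a b = ezero.
Proof.
rewrite /osum orthcK /otimes -[a in ominus a (orthc b)]orthcK ominus_orthc.
exact: ominus_disj.
Qed.

Lemma otimes_eq0 a b : otimes a b = ezero <-> a <= orthc b.
Proof. exact: ominus_eq0. Qed.

Lemma osum_ominus_join a b : osum b (ominus a b) = a `|` b.
Proof. exact/oplus_osumE/oplus_ominus_join. Qed.

Lemma osumK a b : ominus (osum a b) a = orthc a `&` b.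
Proof. exact/oplus_ominusK/oplus_osum. Qed.

(** Distributivity comes from residuation: if every [a `&` b] is below [t], then
    every [a] is below the truncated sum of [t] and [ominus s b], hence so is
    the join [s]. *)
Lemma meet_supremums (A : set E) s b : supremums A s ->
  supremums (image A (fun a => a `&` b)) (s `&` b).
Proof.
move=> [ubs lbs]; split=> [_ [a Aa <-]|t ubt]; first by rewrite leI2 ?ubs.
rewrite -ominus_ominus ominus_leE osumC; apply: lbs => a Aa.
rewrite osumC -ominus_leE; apply: le_trans (ubt _ (ex_intro2 _ _ a Aa erefl)).
by rewrite -ominus_ominus ominus_ler// ominus_lel// ubs.
Qed.

End MVLemmas.

(** * Ideals *)

Section Ideals.
Local Open Scope classical_set_scope.
Local Open Scope order_scope.
Context {d : Order.disp_t} {E : mvEffectAlgType d}.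
Implicit Types a b c u v w x y z : E.
Implicit Types (I P M : set E).

Record ideal I : Prop := Ideal {
  ideal0 : I ezero;
  ideal_le : forall x y, x <= y -> I y -> I x;
  ideal_osum : forall x y, I x -> I y -> I (osum x y)
}.

Record prime_ideal P : Prop := PrimeIdeal {
  prime_is_ideal : ideal P;
  prime_proper : ~ P eone;
  prime_disj : forall x y, (x `&` y)%O = ezero -> P x \/ P y
}.

(** The annihilator of [c]. Prime ideals above it are the points at which [c]
    does not vanish: membership in [polar c] is what can be forced by [c]. *)
Definition polar c : set E := [set x | (x `&` c)%O = ezero].

Definition osumn n x : E := iter n (osum x) ezero.

Lemma osumnD m n x : osumn (m + n) x = osum (osumn m x) (osumn n x).
Proof.
by elim: m => [|m IH]; rewrite ?osum0l// addSn /= -/(osumn _ _) IH osumA.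
Qed.

Lemma ideal_osumn I n x : ideal I -> I x -> I (osumn n x).
Proof.
move=> idI Ix; elim: n => [|n IH]; first exact: ideal0.
exact: ideal_osum.
Qed.

Lemma ideal_polar c : ideal (polar c).
Proof.
split=> [|x y xy|x y].
- by apply: le_ezero; exact: leIl.
- rewrite /polar /= => yc; apply: le_ezero; rewrite -yc; exact: leI2.
- rewrite /polar /= => xc yc; apply: le_ezero; rewrite -xc lexI leIr andbT.
  apply/ominus_eq0/le_ezero; rewrite -yc lexI ominus_leE leIl /=.
  by apply: le_trans (ominus_le _ _) _; exact: leIr.
Qed.

Lemma polar_le c c' : c <= c' -> polar c' `<=` polar c.
Proof.
by move=> cc x; rewrite /polar /= => xc; apply: le_ezero; rewrite -xc leI2.
Qed.

Lemma polar_proper c : c <> ezero -> ~ polar c eone.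
Proof. by move=> c0; rewrite /polar /= (meet_idPr (le_eone c)). Qed.

(** Zorn's lemma gives a maximal proper ideal above [I]. If neither of two
    disjoint elements [x] and [y] were in it, then the complement of some
    element of it would lie below multiples of both, hence be zero. *)
Lemma prime_ideal_exists I : ideal I -> ~ I eone ->
  exists2 P, prime_ideal P & I `<=` P.
Proof.
move=> idI I1.
(* The union with [I] gives the empty chain an upper bound. *)
pose Q : set (set E) := [set J | ideal (J `|` I) /\ ~ (J `|` I) eone].
have [F FQ totF|A [[idA A1] maxA]] := @Zorn_bigcup _ Q.
  split; last by case=> // -[J FJ J1]; have [_] := FQ _ FJ; apply; left.
  have up J : F J -> J `|` I `<=` \bigcup_(X in F) X `|` I.
    by move=> FJ x [Jx|Ix]; [left; exists J|right].
  split=> [|x y xy [[J FJ Jy]|Iy]|x y [[J FJ Jx]|Ix] [[K FK Ky]|Iy]].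
  - by right; exact: ideal0.
  - by apply: (up J) => //; apply: ideal_le xy _; [exact: (FQ _ FJ).1|left].
  - by right; exact: ideal_le Iy.
  - have [JK|KJ] := totF _ _ FJ FK.
      apply: (up K) => //; apply: ideal_osum; first exact: (FQ _ FK).1.
        by left; exact: JK.
      by left.
    apply: (up J) => //; apply: ideal_osum; first exact: (FQ _ FJ).1.
      by left.
    by left; exact: KJ.
  - by apply: (up J) => //; apply: ideal_osum; [exact: (FQ _ FJ).1|left|right].
  - by apply: (up K) => //; apply: ideal_osum; [exact: (FQ _ FK).1|right|left].
  - by right; exact: ideal_osum.
exists (A `|` I)%classic; last by move=> x Ix; right.
have gen x : ~ (A `|` I) x ->
    exists m n, (A `|` I) m /\ osum m (osumn n x) = eone.
  move=> Ax; apply: contrapT => nex.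
  pose B := [set z | exists m n, (A `|` I) m /\ z <= osum m (osumn n x)].
  have AB : A `|` I `<=` B.
    by move=> z Az; exists z, 0%N; rewrite /= osum0.
  have BI : B `|` I = B.
    by apply/seteqP; split=> z; [case=> // Iz; apply: AB; right|left].
  apply: (maxA B).
    split=> [z Az|BA]; first by apply: AB; left.
    apply: Ax; left; apply: BA; exists ezero, 1%N; rewrite osum0l /= osum0.
    by split=> //; exact: ideal0.
  suff : ideal B /\ ~ B eone by rewrite -{1 2}BI.
  split.
    split=> [|y z yz|y z].
    - by apply: AB; exact: ideal0.
    - by move=> [m [n [Am zm]]]; exists m, n; split=> //; exact: le_trans zm.
    - move=> [m [n [Am ym]]] [m' [n' [Am' zm']]].
      exists (osum m m'), (n + n')%N; split; first exact: ideal_osum.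
      rewrite osumnD osumA -(osumA m) (osumC m') osumA -osumA.
      exact: osum_le.
  move=> [m [n [Am m1]]]; apply: nex; exists m, n; split=> //.
  by apply: le_anti; rewrite le_eone /=.
split=> // x y xy; have [?|Ax] := pselect ((A `|` I) x); first by left.
have [?|Ay] := pselect ((A `|` I) y); first by right.
exfalso; apply: A1.
have [m [n [Am mx]]] := gen _ Ax; have [m' [n' [Am' my]]] := gen _ Ay.
suff <- : osum m m' = eone by exact: ideal_osum.
have nxy : (osumn n x `&` osumn n' y)%O = ezero.
  rewrite meetC; apply: (ideal_osumn _ (ideal_polar (osumn n x))).
  rewrite /polar /= meetC.
  exact: (ideal_osumn _ (ideal_polar y)).
apply: le_anti; rewrite le_eone /= -orthc_le orthc1 -nxy lexI.
apply/andP; split; apply/osum_eq1; apply: le_anti; rewrite le_eone /=.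
  by rewrite -mx osum_le// osum_lel.
by rewrite -my osum_le// osum_ler.
Qed.

End Ideals.

(** * Binary expansions *)

Section BinaryExpansion.
Local Open Scope classical_set_scope.
Local Open Scope ring_scope.

(** The limit of the partial sums whose binary digits are the values of [h]
    along the orbit of [a] under [f]. *)
Lemma binary_expansion (R : realType) (T : Type) (h : T -> bool) (f : T -> T) :
  exists w : T -> R, forall a, 0 <= w a <= 1 /\
    w a = ((h a)%:R + w (f a)) / 2.
Proof.
pose W := fix W n a : R :=
  if n is m.+1 then ((h a)%:R + W m (f a)) / 2 else 0.
have h01 a : 0 <= ((h a)%:R : R) <= 1 by case: (h a); rewrite ?lexx ?ler01.
have W01 n a : 0 <= W n a <= 1.
  elim: n a => [|n IH] a /=; first by rewrite lexx ler01.
  by have := IH (f a); have := h01 a; lra.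
have Wnd a : nondecreasing_seq (W ^~ a).
  apply/nondecreasing_seqP => n; elim: n a => [|n IH] a.
    by have /andP[] := W01 1%N a.
  by have := IH (f a); rewrite /=; lra.
have Wcv a : cvgn (W ^~ a).
  apply: nondecreasing_is_cvgn => //; exists 1 => _ [n _ <-].
  by have /andP[] := W01 n a.
exists (fun a => limn (W ^~ a)) => a; split.
  apply/andP; split.
    by apply: limr_ge => //; apply: nearW => n; have /andP[] := W01 n a.
  by apply: limr_le => //; apply: nearW => n; have /andP[] := W01 n a.
have /cvg_ex[l Wl] := Wcv a.
rewrite (cvg_lim _ Wl)//.
have WSl : [sequence (W ^~ a) n.+1]_n @ \oo --> l
  by have := Wl; rewrite -(cvg_shiftS (W ^~ a)).
apply: (cvg_unique _ WSl) => //=.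
apply: cvgMl; apply: cvgD; first exact: cvg_cst.
exact: Wcv.
Qed.

End BinaryExpansion.

(** * The linearly ordered quotient by a prime ideal *)

Section Chain.
Local Open Scope classical_set_scope.
Local Open Scope order_scope.
Context {d : Order.disp_t} {E : mvEffectAlgType d} (P : set E).
Hypothesis primeP : prime_ideal P.
Implicit Types a b c e s t u v x y z : E.

Let idP := prime_is_ideal primeP.

(** The order, equality and partial sum of the linearly ordered quotient of [E]
    by [P], as relations on representatives. *)
Definition ple a b : Prop := P (ominus a b).

Definition peq a b : Prop := ple a b /\ ple b a.

Definition psum a b c : Prop := ple a (orthc b) /\ peq c (osum a b).

Lemma le_ple a b : a <= b -> ple a b.
Proof. by move=> /ominus_eq0 ab; rewrite /ple ab; exact: ideal0. Qed.

Lemma ple_trans b a c : ple a b -> ple b c -> ple a c.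
Proof.
move=> ab bc; apply: (ideal_le idP) (ominus_tri a b c) _.
exact: ideal_osum.
Qed.

Lemma ple_total a b : ple a b \/ ple b a.
Proof. exact: prime_disj primeP _ _ (ominus_disj a b). Qed.

Lemma ple_orthc a b : ple a b -> ple (orthc b) (orthc a).
Proof. by rewrite /ple ominus_orthc. Qed.

Lemma ple_osum a b a' b' : ple a a' -> ple b b' -> ple (osum a b) (osum a' b').
Proof.
move=> aa bb; apply: (@ple_trans (osum a' b)).
  exact: (ideal_le idP) (osum_ominus2 _ _ _) aa.
by rewrite 2!(osumC a'); exact: (ideal_le idP) (osum_ominus2 _ _ _) bb.
Qed.

Lemma ominus_osum a b : ominus a b = orthc (osum (orthc a) b).
Proof. by rewrite /osum !orthcK. Qed.

Lemma ple_ominus a b a' b' : ple a a' -> ple b' b ->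
  ple (ominus a b) (ominus a' b').
Proof.
by move=> aa bb; rewrite !ominus_osum; apply/ple_orthc/ple_osum => //;
  exact: ple_orthc.
Qed.

Lemma peq_refl a : peq a a.
Proof. by split; exact: le_ple. Qed.

Lemma peq_sym a b : peq a b -> peq b a.
Proof. by case. Qed.

Lemma peq_trans b a c : peq a b -> peq b c -> peq a c.
Proof. by move=> [? ?] [? ?]; split; exact: (@ple_trans b). Qed.

Lemma peq_orthc a b : peq a b -> peq (orthc a) (orthc b).
Proof. by move=> [? ?]; split; exact: ple_orthc. Qed.

Lemma peq_osum a b a' b' : peq a a' -> peq b b' -> peq (osum a b) (osum a' b').
Proof. by move=> [? ?] [? ?]; split; exact: ple_osum. Qed.

Lemma peq_ominus a b a' b' : peq a a' -> peq b b' ->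
  peq (ominus a b) (ominus a' b').
Proof. by move=> [? ?] [? ?]; split; exact: ple_ominus. Qed.

Lemma psum_peq a b c a' b' c' : peq a a' -> peq b b' -> peq c c' ->
  psum a b c -> psum a' b' c'.
Proof.
move=> aa bb cc [ab cab]; split.
  apply: ple_trans aa.2 _; apply: ple_trans ab _; exact: (peq_orthc bb).1.
by apply: peq_trans (peq_sym cc) _; apply: peq_trans cab _; exact: peq_osum.
Qed.

Lemma psumC a b c : psum a b c -> psum b a c.
Proof.
by move=> [/ple_orthc]; rewrite orthcK => ba; rewrite osumC.
Qed.

Lemma oplus_psum a b c : oplus a b = Some c -> psum a b c.
Proof.
move=> abc; split; last by rewrite (oplus_osumE abc); exact: peq_refl.
by apply/le_ple; apply: (@oplus_le_orthc _ _ _ _ c); rewrite oplusC.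
Qed.

Lemma psum_osum a b : ple a (orthc b) -> psum a b (osum a b).
Proof. by split=> //; exact: peq_refl. Qed.

Lemma psum_fun a b c c' : psum a b c -> psum a b c' -> peq c c'.
Proof. by move=> [_ ?] [_ /peq_sym]; exact: peq_trans. Qed.

Lemma psum_orthc a : psum a (orthc a) eone.
Proof. exact/oplus_psum/oplus_orthc1. Qed.

Lemma psum0 a : psum a ezero a.
Proof. exact/oplus_psum/oplus0. Qed.

Lemma psum_ominus a b : ple a b -> psum a (ominus b a) b.
Proof.
move=> ab; split; last first.
  split; first by apply/le_ple; rewrite osum_ominus_join leUl.
  by apply: (ideal_le idP) ab; rewrite ominus_leE !osum_ominus_join joinC.
rewrite -[a in ple a _]orthcK; apply/ple_orthc/le_ple.
exact: oplus_le_orthc (oplus_ominus_join b a).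
Qed.

Lemma psum_sub a b c : psum a b c -> peq b (ominus c a).
Proof.
move=> [ab cab]; apply: (@peq_trans (ominus (osum a b) a)); last first.
  by apply: peq_ominus (peq_refl _); exact: peq_sym.
rewrite osumK; split; last by apply: le_ple; exact: leIr.
have ba : ple b (orthc a) by move/ple_orthc : ab; rewrite orthcK.
apply: (ideal_le idP) ba; rewrite ominus_leE meetC.
by rewrite (oplus_osumE (oplus_ominus b (orthc a))).
Qed.

Lemma psum_inj a b b' c : psum a b c -> psum a b' c -> peq b b'.
Proof. by move=> /psum_sub bc /psum_sub/peq_sym; exact: peq_trans. Qed.

Lemma psum_lel a b c : psum a b c -> ple a c.
Proof. by move=> [_ [_ ?]]; apply: ple_trans (le_ple (osum_lel a b)) _. Qed.

Lemma psum_assocl a b c s t : psum a b s -> psum s c t ->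
  exists2 u, psum b c u & psum a u t.
Proof.
move=> abs sct; have sc := sct.1; exists (osum b c).
  apply: psum_osum; apply: ple_trans sc; apply: psum_lel.
  exact: psumC abs.
split; last first.
  rewrite osumA; apply: peq_trans sct.2 _; apply: peq_osum (peq_refl _).
  exact: abs.2.
have cs : ple c (ominus (orthc a) b).
  have /psumC[+ _] := sct; move/ple_trans; apply.
  have := peq_orthc abs.2; rewrite /osum orthcK => -[+ _].
  by [].
rewrite -[a in ple a _]orthcK; apply: ple_orthc.
apply: (@ple_trans (osum b (ominus (orthc a) b))).
  by apply: ple_osum cs; exact: le_ple.
rewrite osum_ominus_join.
have : ple b (orthc a) by have [] := psumC abs.
by apply: (ideal_le idP); rewrite ominus_leE osum_ominus_join joinC.
Qed.

Lemma psum_assocr a b c u t : psum b c u -> psum a u t ->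
  exists2 s, psum a b s & psum s c t.
Proof.
move=> bcu aut; have [s bas sct] := psum_assocl (psumC bcu) (psumC aut).
by exists s; apply: psumC.
Qed.

Lemma psum_congr a b c b' : psum a b c -> peq b b' -> psum a b' c.
Proof. by move=> abc bb; apply: psum_peq abc => //; exact: peq_refl. Qed.

Lemma psum_congl a b c a' : psum a b c -> peq a a' -> psum a' b c.
Proof. by move=> abc aa; apply: psum_peq abc => //; exact: peq_refl. Qed.

Lemma psum_cong a b c c' : psum a b c -> peq c c' -> psum a b c'.
Proof. by move=> abc cc; apply: psum_peq abc => //; exact: peq_refl. Qed.

Lemma psum_orthc_eq a b : psum a b eone -> peq b (orthc a).
Proof. by move=> ab; exact: psum_inj ab (psum_orthc a). Qed.

Lemma psum_compl a b c : psum a b c -> psum b (orthc c) (orthc a).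
Proof.
move=> abc; have [u bcu au] := psum_assocl abc (psum_orthc c).
exact: psum_cong bcu (psum_orthc_eq au).
Qed.

Lemma ple_eone_ezero : ~ ple eone ezero.
Proof. by rewrite /ple ominus0; exact: prime_proper. Qed.

(** If the quotient were the unit interval, this would be the first binary
    digit of [a], and [shift] would be doubling modulo one. *)
Definition digit a : bool := `[< ple (orthc a) a >].

Definition shift a : E := if digit a then otimes a a else osum a a.

Lemma digitF a : digit a = false -> psum a a (shift a).
Proof.
rewrite /shift => aF; rewrite aF; apply: psum_osum.
by have [//|/asboolT] := ple_total a (orthc a); rewrite -/(digit a) aF.
Qed.

Lemma digitT a : digit a -> psum (orthc a) (shift a) a.
Proof. by move=> aT; rewrite /shift aT; apply: psum_ominus; exact/asboolP. Qed.

Lemma digit_ple a b : ple a b -> digit a -> digit b.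
Proof.
move=> ab /asboolP aa; apply/asboolP; apply: ple_trans (ple_orthc ab) _.
exact: ple_trans ab.
Qed.

(** The next three lemmas follow a sum [a + b = c] through one doubling, where
    [A], [B] and [C] are the shifts: with no digit set, with a carry into the
    digit of [c], and with the digits of [a] and [c] set. *)
Lemma psum_double a b c A B C : psum a b c ->
  psum a a A -> psum b b B -> psum c c C -> psum A B C.
Proof.
move=> abc aA bB cC; have [u bcu auC] := psum_assocl abc cC.
have [s bbs sau] := psum_assocr (psumC abc) bcu.
have Bau := psum_congl sau (psum_fun bbs bB).
have [s' aas' sBC] := psum_assocr (psumC Bau) auC.
exact: psum_congl sBC (psum_fun aas' aA).
Qed.

(** Adding [b] to itself and to [orthc B] gives 1, as [c] and [orthc c] do;
    comparing the two ways of writing [a + orthc b] and cancelling [orthc c]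
    leaves [A = orthc B + C]. The order of [a] and [b] makes that sum defined. *)
Lemma psum_carry a b c A B C : psum a b c -> ple a b ->
  psum a a A -> psum b b B -> psum (orthc c) C c -> psum (orthc B) C A.
Proof.
move=> abc ab aA bB cC.
have acb : psum a (orthc c) (orthc b) by exact/psum_compl/psumC.
have bBb : psum b (orthc B) (orthc b) := psum_compl bB.
have abw : psum a (orthc b) (osum a (orthc b)) by apply: psum_osum; rewrite orthcK.
have [s aas scw] := psum_assocr acb abw.
have Acw := psumC (psum_congl scw (psum_fun aas aA)).
have [s' abs' sBw] := psum_assocr bBb abw.
have cBw := psum_congl sBw (psum_fun abs' abc).
have [u CBu cuw] := psum_assocl cC cBw.
exact/psumC/(psum_cong CBu)/(psum_inj cuw Acw).
Qed.

Lemma psum_high a b c A B C : psum a b c ->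
  psum (orthc a) A a -> psum b b B -> psum (orthc c) C c -> psum A B C.
Proof.
move=> abc aA bB cC; have bca := psum_compl abc.
have [u bAu cua] := psum_assocl (psumC bca) aA.
have [v ubv cvc] := psum_assocl cua abc.
have ubC := psum_cong ubv (psum_inj cvc cC).
have [s bbs AsC] := psum_assocl (psumC bAu) ubC.
exact: psum_congr AsC (psum_fun bbs bB).
Qed.

Section Valuation.
Local Open Scope ring_scope.
Variables (R : realType) (w : E -> R).
Hypothesis wE : forall a, 0 <= w a <= 1 /\
  w a = ((digit a)%:R + w (shift a)) / 2.

Lemma geometric_le0 (C x : R) : (forall n, x <= C / 2 ^+ n) -> x <= 0.
Proof.
move=> xC; rewrite leNgt; apply/negP => x0.
have C0 : 0 < C by have := xC 0%N; rewrite expr0 divr1; apply: lt_le_trans.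
have [n] := ltr_add_invr (y := 0) (x := x / C) (divr_gt0 x0 C0).
rewrite add0r => nx; have := xC n.+1.
apply/negP; rewrite -ltNge ltr_pdivrMr ?exprn_gt0//.
move: nx; rewrite ltr_pdivlMr// mulrC ltr_pdivrMr// => /lt_le_trans; apply.
rewrite ler_pM2l// -natrX ler_nat.
exact/ltnW/ltn_expl.
Qed.

Lemma halvesS n : 1 / 2 ^+ n.+1 = (1 / 2 ^+ n) / 2 :> R.
Proof. by rewrite exprSr invfM mulrA. Qed.

(** Doubling an element equal to zero gives zero again, with digit 0. *)
Lemma valuation_peq0 a : peq a ezero -> w a = 0.
Proof.
suff h n : forall a, peq a ezero -> w a <= 1 / 2 ^+ n.
  move=> a0; apply: le_anti; have [/andP[-> _] _] := wE a; rewrite andbT.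
  by apply: (@geometric_le0 1) => n; exact: h.
elim: n => [|n IH] {}a a0.
  by rewrite expr0 divr1; have [/andP[]] := wE a.
have aF : digit a = false.
  apply/asboolP => aa; apply: ple_eone_ezero.
  have := ple_trans (peq_orthc a0).2 (ple_trans aa a0.1).
  by rewrite orthc0.
have [_ ->] := wE a; rewrite aF add0r halvesS ler_pM2r ?invr_gt0//.
apply: IH; apply: psum_fun (digitF aF) _.
by apply: psum_peq (psum0 ezero); [exact: peq_sym..|exact: peq_refl].
Qed.

(** One doubling turns complementary elements into complementary elements and
    halves the error, except at one half, whose two digits are both set. *)
Lemma valuation_orthc a b : psum a b eone -> w a + w b = 1.
Proof.
suff h n : forall a b, psum a b eone -> `|w a + w b - 1| <= 1 / 2 ^+ n.
  move=> ab; apply/eqP; rewrite -subr_eq0 -normr_le0.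
  by apply: (@geometric_le0 1) => n; exact: h.
have peq_sh a1 b1 : psum a1 b1 eone -> digit a1 -> digit b1 -> w (shift a1) = 0.
  move=> ab /[dup] aT /asboolP aa /asboolP bb; apply: valuation_peq0.
  have ba := psum_orthc_eq ab.
  have aa' : peq (orthc a1) a1.
    split=> //; apply: (@ple_trans (orthc b1)).
      have := (peq_orthc ba).2; by rewrite orthcK.
    by apply: ple_trans bb _; exact: ba.1.
  apply: psum_inj (digitT aT) _.
  exact: psum_peq (peq_sym aa') (peq_refl _) (peq_refl _) (psum0 a1).
elim: n => [|n IH] {}a {}b ab.
  rewrite expr0 divr1 ler_norml.
  by have [/andP[? ?] _] := wE a; have [/andP[? ?] _] := wE b; lra.
have step a1 b1 : psum a1 b1 eone -> digit a1 -> digit b1 = false ->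
    `|w a1 + w b1 - 1| <= 1 / 2 ^+ n.+1.
  move=> ab1 aT bF.
  have [_ ->] := wE a1; have [_ ->] := wE b1; rewrite aT bF /=.
  have abb := psum_congl (digitT aT) (peq_sym (psum_orthc_eq ab1)).
  rewrite halvesS.
  have [u bau s1] := psum_assocr abb (psumC ab1).
  have := IH _ _ (psumC (psum_congl s1 (psum_fun bau (digitF bF)))).
  by rewrite !ler_norml; lra.
case aD : (digit a); case bD : (digit b).
- have [_ ->] := wE a; have [_ ->] := wE b.
  rewrite (peq_sh _ _ ab aD bD) (peq_sh _ _ (psumC ab) bD aD) aD bD /=.
  have : 0 <= 1 / 2 ^+ n.+1 :> R by rewrite divr_ge0 ?exprn_ge0.
  by rewrite ler_norml; lra.
- exact: step.
- by rewrite (addrC (w a)); apply: step => //; exact: psumC.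
- have [aa|/asboolT] := ple_total a (orthc a); last by rewrite -/(digit a) aD.
  exfalso; move/negbT/asboolPn : bD; apply.
  have [b1 b2] := psum_orthc_eq ab.
  apply: ple_trans (ple_orthc b2) _; rewrite orthcK.
  exact: ple_trans b2.
Qed.

(** Each doubling halves the defect of additivity. When a carry occurs, the sum
    is rewritten with complements, whose values are already known exactly. *)
Lemma valuation_psum a b c : psum a b c -> w c = w a + w b.
Proof.
suff h n : forall a b c, psum a b c -> `|w c - (w a + w b)| <= 2 * (1 / 2 ^+ n).
  move=> abc; apply/eqP; rewrite -subr_eq0 -normr_le0.
  by apply: (@geometric_le0 2) => n; have := h n _ _ _ abc; rewrite mulrA mulr1.
elim: n => [|n IH] {}a {}b {}c abc.
  rewrite expr0 divr1 mulr1 ler_norml.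
  have [/andP[? ?] _] := wE a; have [/andP[? ?] _] := wE b.
  by have [/andP[? ?] _] := wE c; lra.
have cF_le x : digit c = false -> ple x c -> digit x = false.
  by move=> cF xc; apply: contraFF cF; exact: digit_ple.
have ac := psum_lel abc; have bc := psum_lel (psumC abc).
case cD : (digit c); last first.
  have aD := cF_le _ cD ac; have bD := cF_le _ cD bc.
  have := IH _ _ _ (psum_double abc (digitF aD) (digitF bD) (digitF cD)).
  have [_ ->] := wE a; have [_ ->] := wE b; have [_ ->] := wE c.
  by rewrite aD bD cD halvesS /= !ler_norml; lra.
case aD : (digit a); case bD : (digit b).
- have c1 : peq c eone.
    split; first by apply/le_ple/le_eone.
    apply: ple_trans abc.2.2; rewrite -(osum_orthc a).
    apply: ple_osum (le_ple (lexx a)) _.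
    apply: ple_trans (asboolP _ aD) _; apply: ple_trans abc.1 _; exact: asboolP _ bD.
  have := valuation_orthc (psum_cong abc c1).
  have := valuation_orthc (psum_cong (psum0 c) c1).
  have -> := valuation_peq0 (peq_refl ezero).
  have : 0 <= 1 / 2 ^+ n.+1 :> R by rewrite divr_ge0 ?exprn_ge0.
  by rewrite ler_norml; lra.
- have := IH _ _ _ (psum_high abc (digitT aD) (digitF bD) (digitT cD)).
  have [_ ->] := wE a; have [_ ->] := wE b; have [_ ->] := wE c.
  by rewrite aD bD cD halvesS /= !ler_norml; lra.
- have := IH _ _ _ (psum_high (psumC abc) (digitT bD) (digitF aD) (digitT cD)).
  have [_ ->] := wE a; have [_ ->] := wE b; have [_ ->] := wE c.
  by rewrite aD bD cD halvesS /= !ler_norml; lra.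
- have carry a1 b1 : psum a1 b1 c -> digit a1 = false -> digit b1 = false ->
      ple a1 b1 -> `|w c - (w a1 + w b1)| <= 2 * (1 / 2 ^+ n.+1).
    move=> ab1 a1D b1D ab.
    have := IH _ _ _ (psum_carry ab1 ab (digitF a1D) (digitF b1D) (digitT cD)).
    have := valuation_orthc (psum_orthc (shift b1)).
    have [_ ->] := wE a1; have [_ ->] := wE b1; have [_ ->] := wE c.
    by rewrite a1D b1D cD halvesS /= !ler_norml; lra.
  have [|] := ple_total a b; first exact: carry.
  by rewrite (addrC (w a)); apply: carry => //; exact: psumC.
Qed.

End Valuation.

End Chain.

(** * States *)

Section States.
Local Open Scope classical_set_scope.
Local Open Scope ring_scope.
Context {R : realType} {d : Order.disp_t} {E : mvEffectAlgType d}.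

Record state (w : E -> R) : Prop := State {
  state_ge0 : forall a, 0 <= w a;
  state1 : w eone = 1;
  state_oplus : forall a b c, oplus a b = Some c -> w c = w a + w b
}.

Lemma prime_ideal_state (P : set E) : prime_ideal P ->
  exists2 w : E -> R, state w & forall a, P a -> w a = 0.
Proof.
move=> primeP; have [w wE] := @binary_expansion R E (digit P) (shift P).
exists w; first split.
- by move=> a; have [/andP[]] := wE a.
- have := valuation_orthc primeP wE (psum_orthc primeP ezero).
  rewrite orthc0 (valuation_peq0 primeP wE) ?add0r//.
  exact: peq_refl.
- by move=> a b c /(oplus_psum primeP)/(valuation_psum primeP wE).
- move=> a Pa; apply: (valuation_peq0 primeP wE); split.
    by rewrite /ple ominus0.
  by apply: le_ple => //; exact: ezero_le.
Qed.

End States.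

Section StateLemmas.
Local Open Scope classical_set_scope.
Local Open Scope ring_scope.
Context {R : realType} {d : Order.disp_t} {E : mvEffectAlgType d}.
Variable w : E -> R.
Hypothesis sw : state w.
Implicit Types a b c x y : E.

Lemma state_le a b : (a <= b)%O -> w a <= w b.
Proof.
by move=> /le_oplus[c /(state_oplus sw) ->]; rewrite lerDl state_ge0.
Qed.

Lemma state_le1 a : w a <= 1.
Proof. by rewrite -(state1 sw) state_le// le_eone. Qed.

Lemma state_orthc a : w (orthc a) = 1 - w a.
Proof. by rewrite -(state1 sw) (state_oplus sw (oplus_orthc1 a)) addrC addKr. Qed.

Lemma state_ominus a b : (b <= a)%O -> w (ominus a b) = w a - w b.
Proof. by move=> /oplus_ominus_le/(state_oplus sw) ->; rewrite addrC addKr. Qed.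

Lemma state_osum a b : w (osum a b) <= w a + w b.
Proof. by rewrite (state_oplus sw (oplus_osum a b)) lerD2l state_le// leIr. Qed.

Lemma state0 : w ezero = 0.
Proof. by rewrite -orthc1 state_orthc (state1 sw) subrr. Qed.

Lemma state_osumn n x : w (osumn n x) <= n%:R * w x.
Proof.
elim: n => [|n IH]; first by rewrite state0 mul0r.
rewrite -natr1 mulrDl mul1r addrC; apply: le_trans (state_osum _ _) _.
by rewrite lerD2l.
Qed.

(** What truncation loses when [x] is added to [osumn k x] is disjoint from the
    complement of [osumn k.+1 x], hence from [c]; so [w] does not see it, and
    the value of [osumn m x] is [m%:R * w x]. *)
Lemma state_osumn_le1 c x m : (forall a, polar c a -> w a = 0) ->
  (c <= orthc (osumn m x))%O -> m%:R * w x <= 1.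
Proof.
move=> wc cm; suff <- : w (osumn m x) = m%:R * w x by exact: state_le1.
have : (m <= m)%N by [].
elim: {-2}m => [_|k IH km]; first by rewrite state0 mul0r.
rewrite (state_oplus sw (oplus_osum x _)) -natr1 mulrDl mul1r addrC.
congr (_ + _); rewrite -(IH (ltnW km)) -/(osumn k x).
have := state_oplus sw (oplus_ominus (osumn k x) (orthc x)).
rewrite meetC (wc (ominus _ _)) ?addr0// /polar /=.
apply: le_ezero; rewrite -(otimes_osum_disj (osumn k x) x) -/(otimes _ _) meetC.
rewrite leI2// (le_trans cm)// orthc_le osumC -/(osumn k.+1 x).
by rewrite -(subnK km) osumnD osum_ler.
Qed.

End StateLemmas.

(** * States preserving countably many suprema *)

Section Generic.
Local Open Scope classical_set_scope.
Local Open Scope order_scope.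
Context {d : Order.disp_t} {E : mvEffectAlgType d}.
Implicit Types (a b c x y z t : E) (s : nat -> E).

Definition nondec_sup s t : Prop :=
  (forall n, s n <= s n.+1) /\ supremums (range s) t.

Lemma nondec_le s t m n : nondec_sup s t -> (m <= n)%N -> s m <= s n.
Proof.
move=> [nds _] /subnK <-; elim: (n - m)%N => // k IH.
by apply: le_trans IH _; rewrite addSn.
Qed.

Lemma nondec_sup_ub s t n : nondec_sup s t -> s n <= t.
Proof. by move=> [_ [+ _]]; apply; exists n. Qed.

Lemma nondec_sup_ominus s t z : nondec_sup s t ->
  (forall n, z <= ominus t (s n)) -> z = ezero.
Proof.
move=> st zt; have z_t : z <= t by apply: le_trans (zt 0%N) (ominus_le _ _).
have tz : t <= ominus t z.
  apply: st.2.2 => _ [n _ <-]; have := ominus_ler t (zt n).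
  by rewrite ominus_ominus (meet_idPr (nondec_sup_ub n st)).
have := oplus_ominus_le z_t.
have -> : ominus t z = t by apply: le_anti; rewrite ominus_le.
by rewrite oplusC => /oplus_eq0.
Qed.

(** Let [r n := ominus t (s n)]. For [n >= k], an element below [m.+1] copies of
    [r n] has at most [r n] left after removing [m] copies of [r k]. Letting [n]
    grow, nothing is left, and induction on [m] applies. *)
Lemma nondec_sup_osumn s t m z : nondec_sup s t ->
  (forall n, z <= osumn m (ominus t (s n))) -> z = ezero.
Proof.
move=> st; elim: m z => [|m IH] z zm; first exact/le_ezero/(zm 0%N).
apply: IH => k; apply/ominus_eq0; apply: (nondec_sup_ominus st) => n.
have mono i j : (i <= j)%N -> ominus t (s j) <= ominus t (s i).
  by move=> ij; apply: ominus_ler; exact: nondec_le st ij.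
have osumn_mono x y : x <= y -> osumn m x <= osumn m y.
  by move=> xy; elim: m {zm} => // i IH; exact: osum_le.
set r := maxn k n; apply: (@le_trans _ _ (ominus z (osumn m (ominus t (s r))))).
  by apply/ominus_ler/osumn_mono/mono/leq_maxl.
apply: (@le_trans _ _ (ominus t (s r))); last exact/mono/leq_maxr.
by rewrite ominus_leE osumC; exact: (zm r).
Qed.

End Generic.

Section Archimedean.
Local Open Scope classical_set_scope.
Local Open Scope order_scope.
Context {d : Order.disp_t} {E : sigmaMVEffectAlgType d}.
Implicit Types c : E.

(** Otherwise all multiples of [c] are sums without truncation, and their join
    [t] would satisfy [t <= ominus t c]. *)
Lemma otimes_osumn_neq0 c : c <> ezero ->
  exists n, otimes (osumn n c) (osumn n c) <> ezero.
Proof.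
move=> c0; apply: contrapT => nex.
have h n : osumn n c <= orthc (osumn n c).
  by apply/otimes_eq0; apply: contrapT => hn; apply: nex; exists n.
have [t [ubt lbt]] := countable_join (fun n => osumn n c).
have ct : c <= t by rewrite -[c]osum0; apply: ubt; exists 1%N.
apply: c0; have tc : t <= ominus t c.
  apply: lbt => _ [n _ <-].
  have : osumn n.+1 c <= t by apply: ubt; exists n.+1.
  move=> /(ominus_lel c); apply: le_trans; rewrite /= osumK lexI lexx andbT.
  case: n => [|n]; first exact: ezero_le.
  by rewrite -orthc_le orthcK (le_trans _ (h n.+1))//= osum_lel.
have := oplus_ominus_le ct.
have -> : ominus t c = t by apply: le_anti; rewrite ominus_le.
by rewrite oplusC => /oplus_eq0.
Qed.

End Archimedean.

Section Separation.
Local Open Scope classical_set_scope.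
Local Open Scope ring_scope.
Context {R : realType} {d : Order.disp_t} {E : sigmaMVEffectAlgType d}.
Implicit Types (a b c x y z : E) (D : nat -> (nat -> E) * E).

Definition valid D : Prop := forall k, nondec_sup (D k).1 (D k).2.

Definition generic D (w : E -> R) : Prop := forall k (e : R), 0 < e ->
  exists n, w (D k).2 < w ((D k).1 n) + e.

(** Stage [j] handles one pair [(k, m)]: the remainders of the [k]-th supremum
    decrease to zero, so [m] copies of one of them do not exceed the current
    element, and the difference is the next element. Its annihilator forces
    the value of that remainder to be at most [1 / m]. *)
Lemma generic_state D c : valid D -> c <> ezero ->
  exists w : E -> R, [/\ state w, generic D w & forall a, polar c a -> w a = 0].
Proof.
move=> vD c0.
pose pr j : nat * nat := odflt (0%N, 0%N) (unpickle j).
pose dec (p : nat * E) n :=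
  ominus p.2 (osumn (pr p.1).2 (ominus (D (pr p.1).1).2 ((D (pr p.1).1).1 n))).
have [N decN] : {N & forall p, p.2 <> ezero -> dec p (N p) <> ezero}.
  apply: (@choice _ _ (fun p n => p.2 <> ezero -> dec p n <> ezero)) => p.
  have [p0|p0] := pselect (p.2 = ezero); first by exists 0%N.
  apply: contrapT => nex; apply: p0.
  apply: (nondec_sup_osumn (m := (pr p.1).2) (vD (pr p.1).1)) => n.
  by apply/ominus_eq0; apply: contrapT => pn; apply: nex; exists n.
pose cs := fix cs j := if j is i.+1 then dec (i, cs i) (N (i, cs i)) else c.
have cs0 j : cs j <> ezero by elim: j => //= j; exact: (decN (j, cs j)).
have csS j : (cs j.+1 <= cs j)%O by exact: ominus_le.
have cs_le i j : (i <= j)%N -> (cs j <= cs i)%O.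
  move=> /subnK <-; elim: (j - i)%N => // k IH.
  by rewrite addSn; apply: le_trans (csS _) IH.
have cs_polar i j : (i <= j)%N -> polar (cs i) `<=` polar (cs j).
  by move=> ij; apply: polar_le; exact: cs_le.
pose I := \bigcup_j polar (cs j).
have idI : ideal I.
  split=> [|x y xy [j _ yj]|x y [i _ xi] [j _ yj]].
  - by exists 0%N => //; exact: (ideal0 (ideal_polar _)).
  - by exists j => //; exact: (ideal_le (ideal_polar _)) xy yj.
  - exists (maxn i j) => //; apply: (ideal_osum (ideal_polar _)).
      exact: cs_polar (leq_maxl i j) _ xi.
    exact: cs_polar (leq_maxr i j) _ yj.
have [|P primeP IP] := prime_ideal_exists idI.
  by move=> [j _]; exact: polar_proper.
have [w sw wP] := @prime_ideal_state R _ _ _ primeP.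
have wI j a : polar (cs j) a -> w a = 0 by move=> ?; apply/wP/IP; exists j.
exists w; split=> // [k e e0|]; last exact: (wI 0%N).
have [m] := ltr_add_invr (y := 0) (x := e) e0; rewrite add0r => me.
pose j := pickle (k, m.+1); exists (N (j, cs j)).
have prj : pr j = (k, m.+1) by rewrite /pr /j pickleK.
have := state_osumn_le1 sw (wI j.+1) (m := m.+1)
  (x := ominus (D k).2 ((D k).1 (N (j, cs j)))).
have /[swap]/[apply] : (cs j.+1 <= orthc (osumn m.+1
    (ominus (D k).2 ((D k).1 (N (j, cs j))))))%O.
  rewrite /= /dec /= prj /=; apply: oplus_le_orthc.
  exact: oplus_ominus_join.
rewrite (state_ominus sw) ?(nondec_sup_ub _ (vD k))// -ler_pdivlMl// mulr1.
by move=> /le_lt_trans/(_ me); rewrite ltrBlDl.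
Qed.

(** The construction starts from [otimes (osumn n c) (osumn n c)], where
    [c := ominus a b] and [n] makes it nonzero: where this element does not
    vanish, [osumn n c] exceeds one half, so [c] is at least [1 / (2 * n)],
    and [ominus b a], being disjoint from [c], is zero. *)
Lemma generic_separation D a b : valid D -> ~ (a <= b)%O ->
  exists w : E -> R, [/\ state w, generic D w & w b < w a].
Proof.
move=> vD ab; set c := ominus a b.
have c0 : c <> ezero by move=> /ominus_eq0.
have [n] := otimes_osumn_neq0 c0; set e := otimes _ _ => e0.
have [w [sw gw we]] := generic_state vD e0; exists w; split=> //.
have wba : w (ominus b a) = 0.
  apply: we; apply: (polar_le (_ : e <= osumn n c)%O); first exact: ominus_le.
  rewrite /polar /= meetC; apply: (ideal_osumn _ (ideal_polar _)).
  exact: ominus_disj.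
have wnc : w (orthc (osum (osumn n c) (osumn n c))) = 0.
  by apply: we; exact: otimes_osum_disj.
have : 0 < w c.
  rewrite lt0r (state_ge0 sw) andbT; apply/eqP => wc0.
  move: wnc; rewrite -osumnD (state_orthc sw) => /eqP; rewrite subr_eq0.
  have := state_osumn sw (n + n) c; rewrite wc0 mulr0.
  by move=> /[swap] /eqP <-; rewrite ler10.
rewrite (state_oplus sw (oplus_ominus a b)) (state_oplus sw (oplus_ominus b a)).
by rewrite wba addr0 meetC ltrDl.
Qed.

End Separation.

(** * Probability measures on the line from distribution functions *)

Section RealMeasure.
Local Open Scope classical_set_scope.
Local Open Scope ring_scope.
Context {R : realType}.

Lemma itvNyo_bigcup b (t : R) : `]-oo, t[%classic =
  \bigcup_n [set` Interval -oo%O (BSide b (t - n.+1%:R^-1))].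
Proof.
apply/seteqP; split=> x /=; rewrite in_itv /=.
  move=> /ltr_add_invr[n xt]; exists n => //=.
  by rewrite in_itv /= lteifS// ltrBrDr.
move=> [n _ /=]; rewrite in_itv /= => /lteifW/le_lt_trans; apply.
by rewrite ltrBlDr ltrDl.
Qed.

(** Values are in [R], where those of states are, and continuity from below is
    stated in the form in which [generic] states the preservation of suprema. *)
Record real_prob (m : set R -> R) : Prop := RealProb {
  real_probT : m setT = 1;
  real_prob_ge0 : forall A, measurable A -> 0 <= m A;
  real_probU : forall A B, measurable A -> measurable B -> A `&` B = set0 ->
    m (A `|` B) = m A + m B;
  real_prob_bigcup : forall A : nat -> set R, (forall i, measurable (A i)) ->
    (forall i, A i `<=` A i.+1) ->
    forall e, 0 < e -> exists n, m (\bigcup_i A i) < m (A n) + e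
}.

Lemma real_prob_le (m : set R -> R) A B : real_prob m ->
  measurable A -> measurable B -> A `<=` B -> m A <= m B.
Proof.
move=> pm mA mB AB; have mBA := measurableD mB mA.
rewrite -(setDUK AB) (real_probU pm) ?setDIK//.
by rewrite lerDl real_prob_ge0.
Qed.

Section RightLimit.
Variables (f : R -> R) (alpha beta : R).
Hypothesis ndf : {homo f : x y / x <= y}.
Hypothesis fa : f alpha = 0.
Hypothesis fb : f beta = 1.
Hypothesis f0 : forall x, 0 <= f x.
Hypothesis f1 : forall x, f x <= 1.

Definition right_limit (t : R) : R := inf [set f u | u in [set u | t < u]].

Let has_inf_right t : has_inf [set f u | u in [set u | t < u]].
Proof.
split; first by exists (f (t + 1)), (t + 1) => //=; rewrite ltrDl.
by exists 0 => _ [u _ <-].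
Qed.

Lemma right_limit_le t u : t < u -> right_limit t <= f u.
Proof.
by move=> tu; apply: inf_lbound; [exact: (has_inf_right t).2|exists u].
Qed.

Lemma right_limit_ge t : f t <= right_limit t.
Proof.
apply: lb_le_inf; first exact: (has_inf_right t).1.
by move=> _ [u /= tu <-]; exact/ndf/ltW.
Qed.

Lemma right_limit_nd : nondecreasing right_limit.
Proof.
move=> s t st; apply: lb_le_inf; first exact: (has_inf_right t).1.
by move=> _ [u /= tu <-]; apply: right_limit_le; exact: le_lt_trans tu.
Qed.

Lemma right_limit_rc : right_continuous right_limit.
Proof.
move=> t; apply/cvgrPdist_lt => e e0.
have [_ [u /= tu <-]] := inf_adherent e0 (has_inf_right t).
rewrite -/(right_limit t) => fu.
near=> s; have ts : t < s by near: s; exact: nbhs_right_gt.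
have su : s < u by near: s; exact: nbhs_right_lt.
rewrite distrC ger0_norm ?subr_ge0 ?right_limit_nd// 1?ltW//.
by rewrite ltrBlDl (le_lt_trans (right_limit_le su)).
Unshelve. all: by end_near. Qed.

HB.instance Definition _ :=
  isCumulative.Build R _ R right_limit right_limit_nd right_limit_rc.

Lemma right_limitNy : right_limit @ -oo --> (0 : R).
Proof.
apply: cvg_near_cst; near=> t; apply: le_anti; apply/andP; split.
  rewrite -fa; apply: right_limit_le; near: t; apply: nbhs_ninfty_lt; exact: num_real.
exact: le_trans (f0 t) (right_limit_ge t).
Unshelve. all: by end_near. Qed.

Lemma right_limity : right_limit @ +oo --> (1 : R).
Proof.
apply: cvg_near_cst; near=> t; apply: le_anti; apply/andP; split.
  by apply: le_trans (f1 (t + 1)); apply: right_limit_le; rewrite ltrDl.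
apply: le_trans (right_limit_ge t); rewrite -fb; apply: ndf.
near: t; apply: nbhs_pinfty_ge; exact: num_real.
Unshelve. all: by end_near. Qed.

HB.instance Definition _ :=
  isCumulativeBounded.Build R 0 1 right_limit right_limitNy right_limity.

Lemma real_prob_right_limit : exists2 m : set R -> R, real_prob m &
  forall r, m `]-oo, r]%classic = right_limit r.
Proof.
pose mu : probability _ R := lebesgue_stieltjes_measure right_limit.
pose m (A : set R) := fine (mu A).
have mfin (A : set R) : measurable A -> (m A)%:E = mu A.
  move=> mA; rewrite fineK// ge0_fin_numE//.
  by apply: le_lt_trans (probability_le1 mu mA) _; rewrite ltry.
exists m; last first.
  move=> r; rewrite /m; have := cdf_lebesgue_stieltjes_id right_limit r.
  by rewrite /cdf /distribution /pushforward preimage_id => ->.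
split.
- by rewrite /m probability_setT.
- by move=> A _; exact: fine_ge0.
- move=> A B mA mB AB; apply: EFin_inj; rewrite EFinD !mfin//.
    by rewrite measureU.
  exact: measurableU.
- move=> A mA incA e e0; have mU : measurable (\bigcup_i A i).
    exact: bigcup_measurable.
  have : m (A n) @[n --> \oo] --> m (\bigcup_i A i).
    apply: fine_cvg; rewrite fineK ?ge0_fin_numE//; last first.
      by apply: le_lt_trans (probability_le1 mu mU) _; rewrite ltry.
    apply: nondecreasing_cvg_mu => //.
    by apply/nondecreasing_seqP => n; apply/subsetPset; exact: incA.
  move=> /cvgrPdist_lt/(_ _ e0)[n _ /(_ n (leqnn n))] /=.
  by rewrite ltr_norml => /andP[_]; rewrite ltrBlDl => ?; exists n.
Qed.

End RightLimit.

(** A generic state can make a resolution left continuous at countably many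
    points only, hence the restriction to rationals. The right limit of [f]
    is right continuous, as the distribution function of a measure should be,
    and gives the open half-lines the same values where [f] is left
    continuous. *)
Lemma real_prob_exists (f : R -> R) (alpha beta : R) :
  {homo f : x y / x <= y} -> f alpha = 0 -> f beta = 1 ->
  (forall x, 0 <= f x) -> (forall x, f x <= 1) ->
  (forall (q : rat) e, 0 < e -> exists2 s, s < ratr q & f (ratr q) < f s + e) ->
  exists2 m : set R -> R, real_prob m &
    forall q : rat, m `]-oo, ratr q[%classic = f (ratr q).
Proof.
move=> ndf fa fb f0 f1 lc.
have [m pm mE] := real_prob_right_limit ndf fa fb f0 f1.
exists m => // q; apply/eqP; rewrite eq_le; apply/andP; split.
  apply/ler_addgt0Pr => e e0; rewrite (itvNyo_bigcup true).
  have incl n : `]-oo, ratr q - n.+1%:R^-1[ `<=` `]-oo, ratr q - n.+1%:R^-1 : R].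
    by move=> x /=; rewrite !in_itv /=; exact: ltW.
  have [||n] := real_prob_bigcup pm
    (A := fun n => `]-oo, ratr q - n.+1%:R^-1[%classic) _ _ e0.
  - by move=> i; exact: measurable_itv.
  - move=> i x /=; rewrite !in_itv /= => /lt_le_trans; apply.
    by rewrite lerD2l lerN2 lef_pV2 ?posrE// ler_nat.
  - move=> /ltW/le_trans; apply; rewrite lerD2r.
    apply: le_trans (real_prob_le pm _ _ (incl n)) _ => //.
    by rewrite mE; apply: right_limit_le => //; rewrite ltrBlDr ltrDl.
apply/ler_addgt0Pr => e e0; have [s sq /ltW] := lc q e e0.
move=> /le_trans; apply; rewrite lerD2r.
apply: le_trans (right_limit_ge ndf f0 s) _; rewrite -mE.
apply: (real_prob_le pm) => // x /=; rewrite !in_itv /=.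
by move=> /le_lt_trans; exact.
Qed.

End RealMeasure.

(** * Induction on Borel sets *)

Section BorelInduction.
Local Open Scope classical_set_scope.
Local Open Scope ring_scope.
Context {R : realType}.

Lemma rat_approx (t : R) : exists q : nat -> rat,
  [/\ forall n, q n < q n.+1, forall n, ratr (q n) < t &
      forall s, s < t -> exists n, s < ratr (q n)].
Proof.
have inv2 n : t - n.+1%:R^-1 < t - n.+2%:R^-1.
  by rewrite ltrD2l ltrN2 ltf_pV2 ?posrE// ltr_nat.
have /choice[q qP] n : exists q : rat,
    t - n.+1%:R^-1 < ratr q < t - n.+2%:R^-1.
  have [q] := rat_in_itvoo (inv2 n); rewrite in_itv /= => tq.
  by exists q.
exists q; split=> [n|n|s].
- have /andP[_ q1] := qP n; have /andP[q2 _] := qP n.+1.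
  by rewrite -(ltr_rat R) (lt_trans q1).
- have /andP[_ /lt_trans] := qP n; apply.
  by rewrite ltrBlDr ltrDl.
- move=> /ltr_add_invr[n sn]; exists n; have /andP[+ _] := qP n.
  by apply: lt_trans; rewrite ltrBrDr.
Qed.

(** By the pi-lambda theorem for the half-lines, of which those with real end
    points are increasing unions of those with rational end points. *)
Lemma borel_induction (H : set (set R)) :
  (forall q : rat, H `]-oo, ratr q[%classic) -> H setT ->
  (forall A B, measurable A -> measurable B -> B `<=` A -> H A -> H B ->
     H (A `\` B)) ->
  (forall A : nat -> set R, (forall i, measurable (A i)) ->
     (forall i, A i `<=` A i.+1) -> (forall i, H (A i)) ->
     H (\bigcup_i A i)) ->
  forall A, measurable A -> H A.
Proof.
move=> Hq HT HD HU; pose H' := [set A : set R | measurable A /\ H A].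
have ndP (A : nat -> set R) : nondecreasing_seq A -> forall i, A i `<=` A i.+1.
  by move=> ndA i; apply/subsetPset/ndA.
have lH : lambda_system setT H'.
  split => //.
  - by move=> A B BA [mA HA] [mB HB]; split; [exact: measurableD|exact: HD].
  - move=> A ndA HA; split.
      by apply: bigcup_measurable => i _; exact: (HA i).1.
    by apply: HU; [move=> i; exact: (HA i).1|exact: ndP|move=> i; exact: (HA i).2].
have GH : @RGenInftyO.G R `<=` H'.
  move=> _ [t ->]; split; first exact: measurable_itv.
  have [q [qS qt tq]] := rat_approx t.
  have -> : `]-oo, t[%classic = \bigcup_n `]-oo, ratr (q n) : R[%classic.
    apply/seteqP; split=> x /=; rewrite in_itv /=.
      by move=> /tq[n xn]; exists n.
    by move=> [n _]; rewrite /= in_itv /= => /lt_trans; apply.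
  apply: HU => // i x /=.
  by rewrite !in_itv /= => /lt_trans; apply; rewrite ltr_rat.
have GI : setI_closed (@RGenInftyO.G R).
  move=> _ _ [s ->] [t ->]; exists (Num.min s t).
  by apply/seteqP; split=> x /=; rewrite !in_itv /= lt_min => /andP.
move=> A mA; suff [] : H' A by [].
apply: (lambda_system_subset GI lH GH) => //.
by move: mA; rewrite [X in X A -> _](RGenInftyO.measurableE R).
Qed.

End BorelInduction.

(** * Observables with a given spectral resolution *)

Section Existence.
Local Open Scope classical_set_scope.
Local Open Scope ring_scope.
Context {R : realType} {d : Order.disp_t} {E : sigmaMVEffectAlgType d}.
Variables (F : R -> E) (alpha beta : R).
Hypothesis F_nd : forall s t, s <= t -> (F s <= F t)%O.
Hypothesis F_lc : forall t,
  supremums (range (fun n => F (t - n.+1%:R^-1))) (F t).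
Hypothesis F_alpha : F alpha = ezero.
Hypothesis F_beta : F beta = eone.
Implicit Types (A B : set R) (a b c : E) (w : E -> R).
Implicit Types (D : nat -> (nat -> E) * E).

(** The suprema that express left continuity of [F] at the rationals. *)
Let left_cont : nat -> (nat -> E) * E := fun k =>
  let q : R := ratr (odflt 0 (unpickle k) : rat) in
  (fun n => F (q - n.+1%:R^-1), F q).

Let valid_left_cont : valid left_cont.
Proof.
move=> k; split=> [n|]; last exact: F_lc.
by apply: F_nd; rewrite lerD2l lerN2 lef_pV2 ?posrE// ler_nat.
Qed.

Let distribution_of w (m : set R -> R) : Prop :=
  real_prob m /\ forall q : rat, m `]-oo, ratr q[%classic = w (F (ratr q)).

Let distribution_exists w : state w -> generic left_cont w ->
  exists m, distribution_of w m.
Proof.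
move=> sw gw.
have [||||||m pm mF] := @real_prob_exists R (fun t => w (F t)) alpha beta.
- by move=> s t st; apply: (state_le sw); exact: F_nd.
- by rewrite F_alpha (state0 sw).
- by rewrite F_beta (state1 sw).
- by move=> t; exact: (state_ge0 sw).
- by move=> t; exact: (state_le1 sw).
- move=> q e e0; have [n] := gw (pickle q) e e0.
  rewrite /left_cont /= pickleK /= => qe; exists (ratr q - n.+1%:R^-1) => //.
  by rewrite ltrBlDr ltrDl.
- by exists m.
Qed.

(** The relation that defines the observable, by its traces on states. The
    family [D] depends on [A] and [a], so that it can grow along the
    construction of a Borel set. *)
Let represents A a : Prop := exists2 D, valid D &
  forall w, state w -> generic D w -> generic left_cont w ->
  forall m, distribution_of w m -> m A = w a.

Let merge (Ds : nat -> nat -> (nat -> E) * E) : nat -> (nat -> E) * E :=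
  fun k => let p := odflt (0%N, 0%N) (unpickle k) in Ds p.1 p.2.

Let valid_merge Ds : (forall i, valid (Ds i)) -> valid (merge Ds).
Proof. by move=> vD k; exact: vD. Qed.

Let generic_merge Ds w i : generic (merge Ds) w -> generic (Ds i) w.
Proof.
move=> gD k e e0; have := gD (pickle (i, k)) e e0.
by rewrite /merge pickleK.
Qed.

Let separate (Ds : nat -> nat -> (nat -> E) * E) a b :
  (forall i, valid (Ds i)) ->
  (forall w, state w -> (forall i, generic (Ds i) w) -> w a <= w b) -> (a <= b)%O.
Proof.
move=> vD ab; apply: contrapT => nab.
have [w [sw gw]] := @generic_separation R _ _ _ _ _ (valid_merge vD) nab.
by apply/negP; rewrite -leNgt ab// => i; exact: generic_merge.
Qed.

Let represents_le A B a b : measurable A -> measurable B -> A `<=` B ->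
  represents A a -> represents B b -> (a <= b)%O.
Proof.
move=> mA mB AB [D vD Da] [D' vD' D'b].
apply: (@separate (fun i => match i with 0 => D | 1 => D' | _ => left_cont end)).
  by case=> [|[|i]].
move=> w sw gw; have gl := gw 2%N.
have [m mw] := distribution_exists sw gl.
rewrite -(Da w sw (gw 0%N) gl m mw) -(D'b w sw (gw 1%N) gl m mw).
exact: real_prob_le mw.1 mA mB AB.
Qed.

Let represents_inj A a b : measurable A ->
  represents A a -> represents A b -> a = b.
Proof.
move=> mA Aa Ab; apply: le_anti.
by rewrite (represents_le mA mA _ Aa Ab)// (represents_le mA mA _ Ab Aa).
Qed.

Let representsT : represents setT eone.
Proof.
exists left_cont => // w sw _ _ m [pm _].
by rewrite (real_probT pm) (state1 sw).
Qed.

Let represents_ray (q : rat) : represents `]-oo, ratr q[%classic (F (ratr q)).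
Proof. by exists left_cont => // w _ _ _ m [_ ->]. Qed.

Let representsD A B a b : measurable A -> measurable B -> B `<=` A ->
  represents A a -> represents B b -> represents (A `\` B) (ominus a b).
Proof.
move=> mA mB BA Aa Bb; have ba := represents_le mB mA BA Bb Aa.
move: Aa Bb => [D vD Da] [D' vD' D'b].
exists (merge (fun i => if i is 0 then D else D')).
  by apply: valid_merge => -[].
move=> w sw gw gl m mw; rewrite (state_ominus sw ba).
rewrite -(Da w sw (generic_merge 0 gw) gl m mw).
rewrite -(D'b w sw (generic_merge 1 gw) gl m mw).
apply/eqP; rewrite -subr_eq opprK addrC; apply/eqP.
rewrite -(real_probU mw.1) ?setDIK ?setDUK//.
exact: measurableD.
Qed.

Let represents_bigcup (A : nat -> set R) (a : nat -> E) :
  (forall i, measurable (A i)) -> (forall i, A i `<=` A i.+1) ->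
  (forall i, represents (A i) (a i)) ->
  exists2 b, supremums (range a) b & represents (\bigcup_i A i) b.
Proof.
move=> mA incA Aa; have [b ab] := countable_join a; exists b => //.
have /choice[D DP] i : exists D, valid D /\
    forall w, state w -> generic D w -> generic left_cont w ->
    forall m, distribution_of w m -> m (A i) = w (a i).
  by have [D vD Da] := Aa i; exists D.
have ab_sup : nondec_sup a b.
  by split=> // n; exact: represents_le (Aa n) (Aa n.+1).
pose Ds i := if i is j.+1 then D j else fun=> (a, b).
exists (merge Ds).
  by apply: valid_merge => -[|i] //; exact: (DP i).1.
move=> w sw gw gl m mw.
have mAa i : m (A i) = w (a i) := (DP i).2 w sw (generic_merge i.+1 gw) gl m mw.
have mU : measurable (\bigcup_i A i) by exact: bigcup_measurable.
apply/eqP; rewrite eq_le; apply/andP; split; apply/ler_addgt0Pr => e e0.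
  have [n /ltW/le_trans] := real_prob_bigcup mw.1 mA incA e0; apply.
  by rewrite lerD2r mAa (state_le sw)// (nondec_sup_ub _ ab_sup).
have [n /ltW/le_trans] := generic_merge 0 gw 0%N e0; apply.
by rewrite lerD2r -mAa (real_prob_le mw.1)// => x Ax; exists n.
Qed.

Let represents_exists A : measurable A -> exists a, represents A a.
Proof.
apply: (borel_induction (H := fun A => exists a, represents A a)) => {A}.
- by move=> q; exists (F (ratr q)).
- by exists eone.
- by move=> A B mA mB BA [a Aa] [b Bb]; exists (ominus a b); exact: representsD.
- move=> A mA incA /choice[a Aa].
  by have [b _ Ub] := represents_bigcup mA incA Aa; exists b.
Qed.

Let value A : E := if pselect (measurable A) then xget ezero (represents A) else ezero.

Let valueP A : measurable A -> represents A (value A).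
Proof.
rewrite /value; case: pselect => //= mA _.
exact: (@xgetPex _ ezero (represents A) (represents_exists mA)).
Qed.

Let value_eq A a : measurable A -> represents A a -> value A = a.
Proof. by move=> mA; apply: represents_inj => //; exact: valueP. Qed.

Let value_nonmeasurable A : ~ measurable A -> value A = ezero.
Proof. by rewrite /value; case: pselect. Qed.

Let value_setT : value setT = eone.
Proof. exact: value_eq. Qed.

Let value_setU A B : measurable A -> measurable B -> A `&` B = set0 ->
  oplus (value A) (value B) = Some (value (A `|` B)).
Proof.
move=> mA mB AB0; have mAB := measurableU _ _ mA mB.
have UBA : A `<=` A `|` B by left.
have le_AU := represents_le mA mAB UBA (valueP mA) (valueP mAB).
rewrite -(oplus_ominus_le le_AU); congr (oplus _ _); apply: value_eq => //.
have := representsD mAB mA UBA (valueP mAB) (valueP mA).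
rewrite setDUl setDv set0U setDE; congr represents.
by apply/setIidPl => x Bx Ax; rewrite -[False]/(set0 x) -AB0.
Qed.

Let value_bigcup (A : nat -> set R) : (forall i, measurable (A i)) ->
  (forall i, A i `<=` A i.+1) ->
  supremums (range (fun i => value (A i))) (value (\bigcup_i A i)).
Proof.
move=> mA incA.
have [b vb Ub] := represents_bigcup mA incA (fun i => valueP (mA i)).
by rewrite (value_eq _ Ub)//; exact: bigcup_measurable.
Qed.

Lemma observable_exists : exists x : observable R E, spectral x = F.
Proof.
exists (Observable value_nonmeasurable value_setT value_setU value_bigcup).
have valueq (q : rat) : value `]-oo, ratr q[%classic = F (ratr q).
  by apply: value_eq => //; exact: measurable_itv.
apply/funext => t; rewrite /spectral /=.
have value_le s u : s <= u ->
    (value `]-oo, s[%classic <= value `]-oo, u[%classic)%O.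
  move=> su; apply: (represents_le _ _ _ (valueP _) (valueP _)) => //.
  by move=> x /=; rewrite !in_itv /= => /lt_le_trans; apply.
have rat_below n : exists q : rat, t - n.+1%:R^-1 < ratr q < t.
  have [|q] := @rat_in_itvoo R (t - n.+1%:R^-1) t; first by rewrite ltrBlDr ltrDl.
  by rewrite in_itv /= => tq; exists q.
apply: le_anti; apply/andP; split.
  rewrite (itvNyo_bigcup true t).
  apply: (value_bigcup (A := fun n => `]-oo, t - n.+1%:R^-1[%classic) _ _).2.
  - by move=> i; exact: measurable_itv.
  - move=> i x /=; rewrite !in_itv /= => /lt_le_trans; apply.
    by rewrite lerD2l lerN2 lef_pV2 ?posrE// ler_nat.
  - move=> _ [n _ <-]; have [q /andP[tq qt]] := rat_below n.
    by rewrite (le_trans (value_le _ _ (ltW tq)))// valueq F_nd// ltW.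
apply: (F_lc t).2 => _ [n _ <-]; have [q /andP[tq qt]] := rat_below n.
by rewrite (le_trans (F_nd (ltW tq)))// -valueq value_le// ltW.
Qed.

End Existence.

(** * Sharp elements *)

Section SharpElements.
Local Open Scope classical_set_scope.
Local Open Scope ring_scope.
Context {d : Order.disp_t} {E : mvEffectAlgType d}.
Implicit Types a b : E.

Lemma sharpP a : sharp_elt a <-> (a `&` orthc a)%O = ezero.
Proof.
split=> [[lb glb]|a0].
  by apply: le_ezero; apply: glb => _ [->|->]; [exact: leIl|exact: leIr].
split=> [b _|b lb]; first exact: ezero_le.
by rewrite -a0 lexI; apply/andP; split; apply: lb; [left|right].
Qed.

Lemma sharp_orthc a : sharp_elt a -> sharp_elt (orthc a).
Proof. by move=> /sharpP a0; apply/sharpP; rewrite orthcK meetC. Qed.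

Lemma sharp0 : sharp_elt (ezero : E).
Proof. by apply/sharpP; apply: le_ezero; exact: leIl. Qed.

Lemma sharp1 : sharp_elt (eone : E).
Proof. by rewrite -orthc0; apply/sharp_orthc/sharp0. Qed.

(** An element below [ominus b a] and its complement [osum (orthc b) a] is
    disjoint from both [orthc b] and [a], hence from their truncated sum. *)
Lemma sharp_ominus a b : sharp_elt a -> sharp_elt b -> sharp_elt (ominus b a).
Proof.
move=> /sharpP a0 /sharpP b0; apply/sharpP; set z := (_ `&` _)%O.
have zr : (z <= ominus b a)%O by exact: leIl.
have zb : (z <= b)%O := le_trans zr (ominus_le b a).
have za : (z <= orthc a)%O.
  exact: le_trans zr (oplus_le_orthc (oplus_ominus_join b a)).
have : polar z (osum (orthc b) a).
  apply: (ideal_osum (ideal_polar z)); apply: le_ezero.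
    by rewrite -b0 meetC leI2.
  by rewrite -a0 leI2.
rewrite /osum orthcK /polar /= => <-; apply/esym/meet_idPr.
exact: leIr.
Qed.

Lemma sharp_meet a b : sharp_elt a -> sharp_elt b -> sharp_elt (a `&` b)%O.
Proof.
move=> sa sb; rewrite -ominus_ominus; apply: sharp_ominus => //.
exact: sharp_ominus.
Qed.

Lemma sharp_join a b : sharp_elt a -> sharp_elt b -> sharp_elt (a `|` b)%O.
Proof.
move=> sa sb; rewrite -[(_ `|` _)%O]orthcK orthc_join.
by apply/sharp_orthc/sharp_meet; exact: sharp_orthc.
Qed.

Lemma sharp_supremums (A : set E) a : (forall b, A b -> sharp_elt b) ->
  supremums A a -> sharp_elt a.
Proof.
move=> sA Aa; apply/sharpP/le_ezero.
apply: (meet_supremums (orthc a) Aa).2 => _ [b Ab <-].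
have /sharpP <- := sA b Ab; rewrite leI2// orthc_le.
exact: Aa.1.
Qed.

End SharpElements.

(** * Observables and their spectral resolutions *)

Section ObservableLemmas.
Local Open Scope classical_set_scope.
Local Open Scope ring_scope.
Context {R : realType} {d : Order.disp_t} {E : mvEffectAlgType d}.
Implicit Types (x y : observable R E) (A B : set R) (s t : R) (a b c : E).

Lemma obs_setD x A B : measurable A -> measurable B -> B `<=` A ->
  oplus (x B) (x (A `\` B)) = Some (x A).
Proof.
move=> mA mB BA; rewrite obs_setU ?setDIK ?setDUK//.
exact: measurableD.
Qed.

Lemma obs_le x A B : measurable A -> measurable B -> A `<=` B -> (x A <= x B)%O.
Proof. by move=> mA mB AB; exact: oplus_lel (obs_setD x mB mA AB). Qed.

Lemma obs_ominus x A B : measurable A -> measurable B -> B `<=` A ->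
  x (A `\` B) = ominus (x A) (x B).
Proof. by move=> mA mB BA; rewrite (oplus_ominusK (obs_setD x mA mB BA)). Qed.

Lemma obs_setC x A : measurable A -> x (~` A) = orthc (x A).
Proof.
move=> mA; apply/oplus_orthc; rewrite -setTD obs_setD// obs_setT//.
Qed.

Lemma obs_set0 x : x set0 = ezero.
Proof. by rewrite -setCT obs_setC// obs_setT orthc1. Qed.

Lemma spectral_nd x s t : s <= t -> (spectral x s <= spectral x t)%O.
Proof.
move=> st; apply: obs_le; [exact: measurable_itv..|move=> u /=].
by rewrite !in_itv /= => /lt_le_trans; exact.
Qed.

Lemma spectral_lc x t :
  supremums (range (fun n => spectral x (t - n.+1%:R^-1))) (spectral x t).
Proof.
rewrite /spectral (itvNyo_bigcup true t).
apply: (obs_bigcup x (A := fun n => `]-oo, t - n.+1%:R^-1[%classic)).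
- by move=> i; exact: measurable_itv.
- move=> i u /=; rewrite !in_itv /= => /lt_le_trans; apply.
  by rewrite lerD2l lerN2 lef_pV2 ?posrE// ler_nat.
Qed.

(** The form in which left continuity is used: distributivity takes the limit
    out of the meet. *)
Lemma spectral_meet_le x t b c :
  (forall s, s < t -> (spectral x s `&` b <= c)%O) -> (spectral x t `&` b <= c)%O.
Proof.
move=> xc; apply: (meet_supremums b (spectral_lc x t)).2 => _ [_ [n _ <-] <-].
by apply: xc; rewrite ltrBlDr ltrDl.
Qed.

Lemma spectral_le x t c : (forall s, s < t -> (spectral x s <= c)%O) ->
  (spectral x t <= c)%O.
Proof.
move=> xc; rewrite -(meet_idPl (le_eone (spectral x t))).
by apply: spectral_meet_le => s st; apply: le_trans (xc s st); exact: leIl.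
Qed.

Lemma observable_eq x y : spectral x = spectral y -> x = y.
Proof.
move=> xy; have fxy : obs_fun x = obs_fun y.
  apply/funext => A; have [mA|nA] := pselect (measurable A); last first.
    by rewrite !obs_nonmeasurable.
  apply: (borel_induction (H := fun A => x A = y A)) A mA.
  - by move=> q; have := congr1 (@^~ (ratr q)) xy.
  - by rewrite !obs_setT.
  - by move=> A B mA mB BA xyA xyB; rewrite !obs_ominus// xyA xyB.
  - move=> A mA incA xyA; apply: is_subset1_supremums (obs_bigcup x mA incA) _.
    by under eq_fun do rewrite xyA; exact: obs_bigcup.
case: x y fxy {xy} => [f p1 p2 p3 p4] [g q1 q2 q3 q4] /= fg; subst g.
by congr Observable; exact: Prop_irrelevance.
Qed.

Lemma sharp_spectral x : (forall t, sharp_elt (spectral x t)) -> sharp_obs x.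
Proof.
move=> sx; apply: (borel_induction (H := fun A => sharp_elt (x A))).
- by move=> q; exact: sx.
- by rewrite obs_setT; exact: sharp1.
- by move=> A B mA mB BA sA sB; rewrite obs_ominus//; exact: sharp_ominus.
- move=> A mA incA sA; apply: sharp_supremums (obs_bigcup x mA incA).
  by move=> _ [n _ <-].
Qed.

Lemma bounded_spectral x : bounded_obs x <->
  exists alpha beta, spectral x alpha = ezero /\ spectral x beta = eone.
Proof.
have disj alpha beta : `]-oo, alpha[ `&` `[alpha, beta] = set0 :> set R.
  apply/seteqP; split=> // s [] /=; rewrite !in_itv /= => sa /andP[].
  by rewrite leNgt sa.
have mdisj alpha beta := obs_setU x (measurable_itv `]-oo, alpha[)
  (measurable_itv `[alpha, beta]) (disj alpha beta).
split=> [[alpha [beta xab]]|[alpha [beta [xa xb]]]]; exists alpha.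
  exists (beta + 1); split.
    by apply: oplus_eone; rewrite /spectral -xab mdisj.
  apply: le_anti; rewrite le_eone -xab; apply: obs_le; [exact: measurable_itv..|].
  by move=> s /=; rewrite !in_itv /= => /andP[_ /le_lt_trans]; apply; rewrite ltrDl.
exists beta; have := mdisj alpha beta; rewrite -/(spectral x alpha) xa oplus0l.
move=> [->]; apply: le_anti; rewrite le_eone -xb /=; apply: obs_le.
- exact: measurable_itv.
- by apply: measurableU; exact: measurable_itv.
- move=> s; rewrite /= in_itv /= => sb; have [sa|sa] := ltP s alpha.
    by left; rewrite /= in_itv.
  by right; rewrite /= in_itv /= sa ltW.
Qed.

(** The part of [x A] outside [x (A `&` B)] is [x (A `\` B)], which lies below
    the complement of the sharp element [x B]. *)
Lemma sharp_obs_setI x A B : sharp_obs x -> measurable A -> measurable B ->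
  (x A `&` x B)%O = x (A `&` B).
Proof.
move=> sx mA mB; have mAB := measurableI _ _ mA mB.
apply: le_anti; apply/andP; split; last first.
  by rewrite lexI; apply/andP; split; apply: obs_le => //; move=> s [].
apply/ominus_eq0/le_ezero; have /sharpP <- := sx _ mB; rewrite lexI.
rewrite (le_trans (ominus_le _ _) (leIr _ _)) /=.
apply: le_trans (ominus_lel _ (leIl _ _)) _.
rewrite -obs_ominus//.
rewrite -obs_setC//; apply: obs_le; [exact: measurableD|exact: measurableC|].
by move=> s [As nABs] Bs; apply: nABs.
Qed.

Lemma sharp_obs_setU x A B : sharp_obs x -> measurable A -> measurable B ->
  x (A `|` B) = (x A `|` x B)%O.
Proof.
move=> sx mA mB; apply: (can_inj (@orthcK _ E)).
rewrite -obs_setC; last exact: measurableU.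
by rewrite setCU orthc_join -!obs_setC// sharp_obs_setI//; exact: measurableC.
Qed.

End ObservableLemmas.

(** * Sums of bounded observables *)

Section Sums.
Local Open Scope classical_set_scope.
Local Open Scope ring_scope.
Context {R : realType} {d : Order.disp_t} {E : sigmaMVEffectAlgType d}.
Implicit Types (x y z : observable R E) (A B : set R) (r s t u : R) (a b c : E).

Definition left_continuous_resolution (F : R -> E) : Prop :=
  [/\ forall s t, s <= t -> (F s <= F t)%O,
      forall t c, (forall s, s < t -> (F s <= c)%O) -> (F t <= c)%O,
      exists alpha, F alpha = ezero & exists beta, F beta = eone].

Lemma bounded_observable_exists (F : R -> E) : left_continuous_resolution F ->
  exists2 x, spectral x = F & bounded_obs x.
Proof.
move=> [nd lc [alpha Fa] [beta Fb]].
have [|x xF] := @observable_exists R d E F alpha beta nd _ Fa Fb.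
  move=> t; split=> [_ [n _ <-]|b ub].
    by apply: nd; rewrite lerBlDr lerDl.
  apply: lc => s /ltr_add_invr[n sn]; apply: le_trans (ub _ _); last by exists n.
  by apply: nd; rewrite lerBrDr ltW.
by exists x => //; apply/bounded_spectral; exists alpha, beta; rewrite xF.
Qed.

Lemma countable_join_rat (a : rat -> E) : supremums (range a) !=set0.
Proof.
have [b] := countable_join (fun n => a (odflt 0 (unpickle n))).
suff -> : range (fun n => a (odflt 0 (unpickle n))) = range a by exists b.
apply/seteqP; split=> _ [q _ <-]; first by exists (odflt 0 (unpickle q)).
by exists (pickle q) => //; rewrite pickleK.
Qed.

Definition is_sum_spectral x y (F : R -> E) : Prop := forall t, supremums
  (range (fun q : rat => (spectral x (ratr q) `&` spectral y (t - ratr q))%O)) (F t).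

(** The join defining the sum runs over rational splittings of [s + t]; left
    continuity of [spectral x] gives the real ones. *)
Lemma sum_spectral_ge x y F s t : is_sum_spectral x y F ->
  (spectral x s `&` spectral y t <= F (s + t))%O.
Proof.
move=> xyF; apply: spectral_meet_le => r rs.
have [q] := @rat_in_itvoo R r s rs; rewrite in_itv /= => /andP[rq qs].
apply: le_trans ((xyF (s + t)).1 _ (ex_intro2 _ _ q I erefl)).
by rewrite leI2 ?spectral_nd// ?(ltW rq)// lerBrDr addrC lerD2r ltW.
Qed.

Lemma sum_spectral_meet_le x y F t b c : is_sum_spectral x y F ->
  (forall s, (spectral x s `&` spectral y (t - s) `&` b <= c)%O) ->
  (F t `&` b <= c)%O.
Proof.
move=> xyF xyc; apply: (meet_supremums b (xyF t)).2 => _ [_ [q _ <-] <-].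
exact: xyc.
Qed.

Lemma sum_spectral_le x y F t c : is_sum_spectral x y F ->
  (forall s, (spectral x s `&` spectral y (t - s) <= c)%O) -> (F t <= c)%O.
Proof. by move=> xyF xyc; apply: (xyF t).2 => _ [q _ <-]; exact: xyc. Qed.

Lemma sum_spectral_resolution x y F : bounded_obs x -> bounded_obs y ->
  is_sum_spectral x y F -> left_continuous_resolution F.
Proof.
move=> /bounded_spectral[a [b [xa xb]]] /bounded_spectral[a' [b' [ya yb]]] xyF.
split.
- move=> s t st; apply: (sum_spectral_le xyF) => r.
  have := sum_spectral_ge r (t - r) xyF; rewrite (addrC r) subrK; apply: le_trans.
  by rewrite leI2// spectral_nd// lerD2r.
- move=> t c Fc; apply: (sum_spectral_le xyF) => s; rewrite meetC.
  apply: spectral_meet_le => r rt; rewrite meetC.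
  by apply: le_trans (sum_spectral_ge s r xyF) (Fc _ _); rewrite addrC -ltrBrDr.
- exists (a + a'); apply/le_ezero/(sum_spectral_le xyF) => s.
  have [sa|sa] := leP s a.
    by rewrite -xa (le_trans (leIl _ _))// spectral_nd.
  by rewrite -ya (le_trans (leIr _ _))// spectral_nd//; lra.
- exists (b + b'); apply: le_anti; rewrite le_eone /=.
  by have := sum_spectral_ge b b' xyF; rewrite xb yb meetxx.
Qed.

Lemma obs_sum_unique x y : bounded_obs x -> bounded_obs y ->
  exists! z, is_obs_sum x y z.
Proof.
move=> bx yb; have /choice[F xyF] t := countable_join_rat (fun q : rat =>
  (spectral x (ratr q) `&` spectral y (t - ratr q))%O).
have [z zF bz] := bounded_observable_exists (sum_spectral_resolution bx yb xyF).
exists z; split; first by split=> // t; rewrite zF; exact: xyF.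
move=> z' [_ xyz']; apply: observable_eq; apply/funext => t; rewrite zF.
exact: is_subset1_supremums (xyF t) (xyz' t).
Qed.

Lemma obs_sumP x y : bounded_obs x -> bounded_obs y ->
  is_obs_sum x y (obs_sum x y).
Proof.
move=> bx yb; have [z [xyz _]] := obs_sum_unique bx yb.
exact: (@xgetPex _ x (is_obs_sum x y) (ex_intro _ z xyz)).
Qed.

Lemma bounded_obs_sum x y : bounded_obs x -> bounded_obs y ->
  bounded_obs (obs_sum x y).
Proof. by move=> bx yb; exact: (obs_sumP bx yb).1. Qed.

Lemma spectral_obs_sum x y : bounded_obs x -> bounded_obs y ->
  is_sum_spectral x y (spectral (obs_sum x y)).
Proof. by move=> bx yb; exact: (obs_sumP bx yb).2. Qed.

Lemma obs_sumC x y : bounded_obs x -> bounded_obs y ->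
  obs_sum x y = obs_sum y x.
Proof.
move=> bx yb; apply: observable_eq; apply/funext => t.
have le (u v : observable R E) : bounded_obs u -> bounded_obs v ->
    (spectral (obs_sum u v) t <= spectral (obs_sum v u) t)%O.
  move=> bu bv; apply: (sum_spectral_le (spectral_obs_sum bu bv)) => s.
  have := sum_spectral_ge (t - s) s (spectral_obs_sum bv bu).
  by rewrite subrK meetC.
by apply: le_anti; rewrite !le.
Qed.

(** Both sides are joins of meets [x s `&` y r `&` z u] over splittings
    [s + r + u = t] of the argument. *)
Lemma obs_sumA x y z : bounded_obs x -> bounded_obs y -> bounded_obs z ->
  obs_sum x (obs_sum y z) = obs_sum (obs_sum x y) z.
Proof.
have le (u v w : observable R E) : bounded_obs u -> bounded_obs v -> bounded_obs w ->
    forall t, (spectral (obs_sum u (obs_sum v w)) t <=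
               spectral (obs_sum (obs_sum u v) w) t)%O.
  move=> bu bv bw t; have bvw := bounded_obs_sum bv bw.
  have buv := bounded_obs_sum bu bv.
  apply: (sum_spectral_le (spectral_obs_sum bu bvw)) => s; rewrite meetC.
  apply: (sum_spectral_meet_le (spectral_obs_sum bv bw)) => r.
  have := sum_spectral_ge (s + r) (t - s - r) (spectral_obs_sum buv bw).
  have -> : s + r + (t - s - r) = t by ring.
  apply: le_trans; rewrite meetC meetA leI2//.
  exact: sum_spectral_ge (spectral_obs_sum bu bv).
move=> bx yb bz; apply: observable_eq; apply/funext => t.
apply: le_anti; rewrite le//=.
rewrite (obs_sumC (bounded_obs_sum bx yb) bz) (obs_sumC bx yb).
rewrite (obs_sumC bx (bounded_obs_sum yb bz)) (obs_sumC yb bz).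
exact: le.
Qed.

Lemma obs_sum_mono x y z : bounded_obs x -> bounded_obs y -> bounded_obs z ->
  olson_le x y -> olson_le (obs_sum x z) (obs_sum y z).
Proof.
move=> bx yb bz xy t; apply: (sum_spectral_le (spectral_obs_sum yb bz)) => s.
have := sum_spectral_ge s (t - s) (spectral_obs_sum bx bz).
by rewrite (addrC s) subrK; apply: le_trans; rewrite leI2// xy.
Qed.

Lemma sharp_obs_sum x y : bounded_obs x -> bounded_obs y ->
  sharp_obs x -> sharp_obs y -> sharp_obs (obs_sum x y).
Proof.
move=> bx yb sx sy; apply: sharp_spectral => t.
apply: sharp_supremums (spectral_obs_sum bx yb t) => _ [q _ <-].
by apply: sharp_meet; [apply: sx|apply: sy]; exact: measurable_itv.
Qed.

(** * Questions *)

Lemma sharp_question a : sharp_elt a -> sharp_obs (question R a).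
Proof.
move=> sa A mA; rewrite /= /question_fun asboolT//=.
by do 2 case: ifP => _ //; [exact: sharp1|exact: sharp_orthc|exact: sharp0].
Qed.

Lemma spectral_question_eone t :
  spectral (question R (eone : E)) t = if 1 < t then eone else ezero.
Proof.
rewrite /spectral /= /question_fun (asboolT (measurable_itv _)) /= orthc1.
rewrite !in_itv /=; case: asboolP; case: asboolP => //.
- by move=> _ ->.
- by move=> _ ->.
- by move=> _ /negP/negbTE ->.
- by move=> _ /negP/negbTE ->.
Qed.

Lemma spectral_question_ezero t :
  spectral (question R (ezero : E)) t = if 0 < t then eone else ezero.
Proof.
rewrite /spectral /= /question_fun (asboolT (measurable_itv _)) /= orthc0.
rewrite !in_itv /=; have [t0|t0] := ltP 0 t.
  by case: asboolP => // _; rewrite asboolT.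
by rewrite !asboolF// -?leNgt//; lra.
Qed.

Lemma bounded_question_ezero : bounded_obs (question R (ezero : E)).
Proof.
by apply/bounded_spectral; exists 0, 1; rewrite !spectral_question_ezero ltxx ltr01.
Qed.

Lemma bounded_question_eone : bounded_obs (question R (eone : E)).
Proof.
apply/bounded_spectral; exists 1, 2; rewrite !spectral_question_eone ltxx.
by rewrite ltr1n.
Qed.

Lemma obs_sum0 x : bounded_obs x -> obs_sum (question R ezero) x = x.
Proof.
move=> bx; have b0 := bounded_question_ezero; have S := spectral_obs_sum b0 bx.
apply: observable_eq; apply/funext => t; apply: le_anti; apply/andP; split.
  apply: (sum_spectral_le S) => s; rewrite spectral_question_ezero.
  case: ltP => s0; last by rewrite (le_trans (leIl _ _))// ezero_le.
  by rewrite (le_trans (leIr _ _))// spectral_nd// lerBlDr lerDl ltW.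
apply: spectral_le => s st; have := sum_spectral_ge (t - s) s S.
rewrite subrK spectral_question_ezero subr_gt0 st; apply: le_trans.
by rewrite lexI le_eone /=.
Qed.

Lemma spectral_iter_question_eone n t : t <= n%:R ->
  bounded_obs (iter n (obs_sum (question R (eone : E))) (question R ezero)) /\
  spectral (iter n (obs_sum (question R (eone : E))) (question R ezero)) t = ezero.
Proof.
elim: n t => [|n IH] t tn.
  split; first exact: bounded_question_ezero.
  by have := spectral_question_ezero t; rewrite ltNge tn.
have [bn _] := IH n%:R (lexx _); rewrite iterS; set y := iter n _ _ in bn IH *.
have b1 := bounded_question_eone; split; first exact: bounded_obs_sum.
apply/le_ezero/(sum_spectral_le (spectral_obs_sum b1 bn)) => s.
rewrite spectral_question_eone; case: ltP => s1; last exact: leIl.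
have [|_ ->] := IH (t - s); last exact: leIr.
by move: tn; rewrite -natr1; lra.
Qed.

Lemma question_ezero_le_eone :
  olson_le (question R (ezero : E)) (question R (eone : E)).
Proof.
move=> t; rewrite spectral_question_eone spectral_question_ezero.
case: ltP => t1; last exact: ezero_le.
by rewrite (lt_trans ltr01 t1).
Qed.

Lemma question_eone_strong x : bounded_obs x -> exists2 n : nat, (1 <= n)%N &
  olson_le x (iter n (obs_sum (question R (eone : E))) (question R ezero)).
Proof.
move=> /bounded_spectral[a [b [_ xb]]].
exists (Num.truncn b).+1 => // t; set n := (Num.truncn b).+1.
have [tn|nt] := leP t n%:R.
  by rewrite (spectral_iter_question_eone tn).2 ezero_le.
rewrite (le_trans (le_eone _))// -xb spectral_nd// ltW//.
by rewrite (lt_trans _ nt)// truncnS_gt.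
Qed.

(** * Opposites of sharp observables *)

Section Opposite.
Variable x : observable R E.

Let neg A : E := x (-%R @^-1` A).

Let measurable_neg A : measurable A -> measurable (-%R @^-1` A : set R).
Proof.
by move=> mA; rewrite -[X in measurable X]setTI; exact: oppr_measurable.
Qed.

Let neg_nonmeasurable A : ~ measurable A -> neg A = ezero.
Proof.
move=> nA; apply: obs_nonmeasurable => mA; apply: nA.
have -> : A = -%R @^-1` (-%R @^-1` A).
  by apply/seteqP; split=> t /=; rewrite opprK.
exact: measurable_neg.
Qed.

Let neg_setT : neg setT = eone.
Proof. exact: obs_setT. Qed.

Let neg_setU A B : measurable A -> measurable B -> A `&` B = set0 ->
  oplus (neg A) (neg B) = Some (neg (A `|` B)).
Proof.
move=> mA mB AB; rewrite /neg preimage_setU; apply: obs_setU.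
- exact: measurable_neg.
- exact: measurable_neg.
- by rewrite -preimage_setI AB preimage_set0.
Qed.

Let neg_bigcup (A : nat -> set R) : (forall i, measurable (A i)) ->
  (forall i, A i `<=` A i.+1) ->
  supremums (range (fun i => neg (A i))) (neg (\bigcup_i A i)).
Proof.
move=> mA incA; rewrite /neg preimage_bigcup.
apply: (obs_bigcup x (A := fun i => -%R @^-1` A i)).
- by move=> i; exact: measurable_neg.
- by move=> i t; exact: incA.
Qed.

Definition obs_opp : observable R E :=
  Observable neg_nonmeasurable neg_setT neg_setU neg_bigcup.

Lemma sharp_obs_opp : sharp_obs x -> sharp_obs obs_opp.
Proof. by move=> sx A mA; apply: sx; exact: measurable_neg. Qed.

Lemma bounded_obs_opp : bounded_obs x -> bounded_obs obs_opp.
Proof.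
move=> [a [b xab]]; exists (- b), (- a); rewrite /= /neg -xab; congr (obs_fun x).
by apply/seteqP; split=> t /=; rewrite !in_itv /= !lerN2 andbC.
Qed.

Lemma spectral_obs_opp t : spectral obs_opp t = x `]- t, +oo[%classic.
Proof.
rewrite /spectral /= /neg; congr (obs_fun x).
by apply/seteqP; split=> s /=; rewrite !in_itv /= andbT ltrNl.
Qed.

(** The meets that make up the sum at [t] are the values of [x] on the open
    intervals of length [t]. If [t > 0], then steps of length [t / 2] climb
    from a half-line where [x] vanishes to one where it is 1, and each step
    stays inside one such interval. *)
Lemma obs_sum_opp : sharp_obs x -> bounded_obs x ->
  obs_sum obs_opp x = question R ezero.
Proof.
move=> sx bx; have S := spectral_obs_sum (bounded_obs_opp bx) bx.
apply: observable_eq; apply/funext => t; rewrite spectral_question_ezero.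
have itvE s u : (spectral obs_opp s `&` spectral x u)%O = x `]- s, u[%classic.
  rewrite spectral_obs_opp sharp_obs_setI//; [|exact: measurable_itv..].
  congr (obs_fun x); apply/seteqP; split=> r /=.
    by case; rewrite !in_itv /= andbT => -> ->.
  by rewrite !in_itv /= andbT => /andP[].
case: ltP => t0; last first.
  apply/le_ezero/(sum_spectral_le S) => s; rewrite itvE set_itv_ge ?obs_set0//.
  by rewrite bnd_simp -leNgt; lra.
apply: le_anti; rewrite le_eone /=.
have cover s : (x `]s, (s + t)[%classic <= spectral (obs_sum obs_opp x) t)%O.
  have := sum_spectral_ge (- s) (s + t) S.
  by rewrite itvE opprK addrA addNr add0r.
have [a [b [xa xb]]] := (bounded_spectral x).1 bx.
have below n : (spectral x (a + n%:R * (t / 2)) <= spectral (obs_sum obs_opp x) t)%O.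
  elim: n => [|n IH]; first by rewrite mul0r addr0 xa ezero_le.
  set c := a + n%:R * (t / 2) in IH *.
  apply: (@le_trans _ _ (x (`]-oo, c[ `|` `]c - t / 2, (c - t / 2 + t)[))).
    apply: obs_le; [exact: measurable_itv|by apply: measurableU; exact: measurable_itv|].
    move=> s; rewrite /= !in_itv /= => sc; have [?|cs] := ltP s c; [by left|right].
    by move: sc; rewrite -natr1 mulrDl mul1r addrA -/c; lra.
  rewrite sharp_obs_setU//; [|exact: measurable_itv..].
  by rewrite leUx IH cover.
have [n nb] : exists n, b <= a + n%:R * (t / 2).
  exists (Num.truncn ((b - a) / (t / 2))).+1.
  rewrite -lerBlDl -ler_pdivrMr; last by lra.
  exact/ltW/truncnS_gt.
by rewrite -xb (le_trans _ (below n))// spectral_nd.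
Qed.

End Opposite.

(** * Lattice operations for the Olson order *)

Lemma spectral_meet_exists x y : bounded_obs x -> bounded_obs y ->
  exists2 z, bounded_obs z &
    forall t, spectral z t = (spectral x t `&` spectral y t)%O.
Proof.
move=> bx yb.
have [|z zE bz] := @bounded_observable_exists
  (fun t => (spectral x t `&` spectral y t)%O); last by exists z; rewrite ?zE.
have [a [b [xa xb]]] := (bounded_spectral x).1 bx.
have [a' [b' [ya yb']]] := (bounded_spectral y).1 yb.
split.
- by move=> s t st; rewrite leI2// spectral_nd.
- move=> t c xyc; apply: spectral_meet_le => s st; rewrite meetC.
  apply: spectral_meet_le => r rt; rewrite meetC.
  have m_lt : Num.max s r < t by rewrite gt_max st.
  apply: le_trans (xyc _ m_lt).
  by rewrite leI2 ?spectral_nd// le_max lexx ?orbT.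
- by exists a; rewrite xa; apply/le_ezero/leIl.
- exists (Num.max b b'); apply: le_anti; rewrite le_eone lexI /=.
  by rewrite -{1}xb -yb' !spectral_nd// le_max lexx ?orbT.
Qed.

Lemma spectral_join_exists x y : bounded_obs x -> bounded_obs y ->
  exists2 z, bounded_obs z &
    forall t, spectral z t = (spectral x t `|` spectral y t)%O.
Proof.
move=> bx yb.
have [|z zE bz] := @bounded_observable_exists
  (fun t => (spectral x t `|` spectral y t)%O); last by exists z; rewrite ?zE.
have [a [b [xa xb]]] := (bounded_spectral x).1 bx.
have [a' [b' [ya yb']]] := (bounded_spectral y).1 yb.
split.
- by move=> s t st; rewrite leU2// spectral_nd.
- move=> t c xyc; rewrite leUx; apply/andP; split; apply: spectral_le => s st.
    exact: le_trans (leUl _ _) (xyc s st).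
  exact: le_trans (leUr _ _) (xyc s st).
- exists (Num.min a a'); apply/le_ezero; rewrite leUx.
  by rewrite -{1}xa -ya !spectral_nd// ge_min lexx ?orbT.
- by exists b; rewrite xb; apply: le_anti; rewrite le_eone leUl.
Qed.

End Sums.

Theorem theorem4p6 (R : realType) (d : Order.disp_t)
    (E : sigmaMVEffectAlgType d) :
  [/\ (forall x y : observable R E, BO x -> BO y ->
         exists! z : observable R E, is_obs_sum x y z),
      unital_lgroup_on (@SBO R d E) (@obs_sum R d E) (@olson_le R d E)
        (question R eone),
      po_semigroup_on (@BO R d E) (@obs_sum R d E) (@olson_le R d E) &
      subsemigroup_of (@SBO R d E) (@BO R d E) (@obs_sum R d E)].
Proof.
have semiS : semigroup_on (@SBO R d E) (@obs_sum R d E).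
  split=> [x y [sx bx] [sy yb]|x y z [_ bx] [_ yb] [_ bz]].
    by split; [exact: sharp_obs_sum|exact: bounded_obs_sum].
  exact: obs_sumA.
have po (S : set (observable R E)) : partial_order_on S (@olson_le R d E).
  split=> [x _ t //|x y _ _ xy yx|x y z _ _ _ xy yz t].
    apply: observable_eq; apply/funext => t.
    by apply: le_anti; rewrite xy yx.
  exact: le_trans (yz t) (xy t).
have S0 : SBO (question R (ezero : E)).
  by split; [exact/sharp_question/sharp0|exact: bounded_question_ezero].
have S1 : SBO (question R (eone : E)).
  by split; [exact/sharp_question/sharp1|exact: bounded_question_eone].
have sharpB (x : observable R E) t : SBO x -> sharp_elt (spectral x t).
  by move=> [sx _]; apply: sx; exact: measurable_itv.
split.
- by move=> x y; exact: obs_sum_unique.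
- exists (question R ezero); split; last first.
    split=> // [|g [_ bg]]; first exact: question_ezero_le_eone.
    exact: question_eone_strong.
  split.
  + split=> // [x y [_ bx] [_ yb]|x [_ bx]|x [sx bx]].
    * exact: obs_sumC.
    * exact: obs_sum0.
    * exists (obs_opp x); last exact: obs_sum_opp.
      by split; [exact: sharp_obs_opp|exact: bounded_obs_opp].
  + split=> // x y Sx Sy.
    * have [z bz zE] := spectral_meet_exists Sx.2 Sy.2.
      exists z; split=> [|t|t|w _ xw yw t].
      - split=> //; apply: sharp_spectral => t; rewrite zE.
        by apply: sharp_meet; exact: sharpB.
      - by rewrite zE leIl.
      - by rewrite zE leIr.
      - by rewrite zE lexI xw yw.
    * have [z bz zE] := spectral_join_exists Sx.2 Sy.2.
      exists z; split=> [|t|t|w _ xw yw t].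
      - split=> //; apply: sharp_spectral => t; rewrite zE.
        by apply: sharp_join; exact: sharpB.
      - by rewrite zE leUl.
      - by rewrite zE leUr.
      - by rewrite zE leUx xw yw.
  + by move=> x y z [_ bx] [_ yb] [_ bz]; exact: obs_sum_mono.
- split=> //.
    split=> [x y bx yb|x y z bx yb bz]; first exact: bounded_obs_sum.
    exact: obs_sumA.
  by move=> x y z bx yb bz; exact: obs_sum_mono.
- by split=> // x [].
Qed.
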